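(* There exist unique regular $\mathbf{Q}$-valued measures $\mu$ and $\nu$ for $G$ satisfying, for all $n \ge 1$, $$\mu(X(n))=(-2)^{n-1}, \qquad \nu(X(n))=(-1)^{n-1}.$$
   Context: Let $\mathfrak{X}$ be a Cantor space (a topological space homeomorphic to the Cantor set), and let $G$ be the group of all self-homeomorphisms of $\mathfrak{X}$. For a subset $\mathfrak{A} \subset \mathfrak{X}$ let $G\{\mathfrak{A}\}=\{g \in G : g\mathfrak{A}=\mathfrak{A}\}$. Let $\mathscr{E}$ be the collection of all subgroups of $G$ of the form $G\{\mathfrak{A}_1\} \cap \cdots \cap G\{\mathfrak{A}_n\}$ with $\mathfrak{A}_1,\ldots,\mathfrak{A}_n$ clopen subsets of $\mathfrak{X}$. Topologize $G$ by taking $\mathscr{E}$ as a neighborhood basis of the identity. A ''$G$-set'' is a set with a smooth $G$-action, i.e., all point stabilizers are open subgroups. A $G$-set is finitary if it has finitely many orbits. $\mathbf{S}(G)$ is the category of finitary $G$-sets and $G$-equivariant maps (it is closed under fiber products). $\mathbf{1}$ is the one-point $G$-set. A measure for $G$ valued in a commutative ring $k$ is a rule $\mu$ assigning to each map $f\colon X \to Y$ in $\mathbf{S}(G)$, with $Y$ transitive, a value $\mu(f) \in k$ such that: (a) if $f$ is an isomorphism then $\mu(f)=1$; (b) if $X=X_1 \amalg X_2$ is a decomposition into $G$-sets and $f_i=f|_{X_i}$, then $\mu(f)=\mu(f_1)+\mu(f_2)$; (c) if $g \colon Y \to Z$ is a map of transitive $G$-sets then $\mu(g \circ f)=\mu(g)\mu(f)$;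 (d) if $Y' \to Y$ is a map of transitive $G$-sets and $f' \colon X' \to Y'$ is the base change of $f$, then $\mu(f')=\mu(f)$. For a finitary $G$-set $X$ put $\mu(X)=\mu(X \to \mathbf{1})$. The measure $\mu$ is regular if $\mu(f)$ is a unit of $k$ whenever $f \colon X \to Y$ is a map of transitive $G$-sets. For $n \ge 1$, $X(n)$ is the $G$-set of all surjective continuous maps $\mathfrak{X} \to [n]=\{1,\ldots,n\}$, where $[n]$ is discrete. *)

(* Defs.v *)
From HB Require Import structures.
From mathcomp Require Import all_boot all_order all_algebra.
From mathcomp Require Import all_classical topology cantor.

Set Implicit Arguments.
Unset Strict Implicit.
Unset Printing Implicit Defensive.

Import GRing.Theory.

Local Open Scope classical_set_scope.

Record homeo (S T : topologicalType) := Homeo {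
  homeo_fun :> S -> T;
  homeo_inv : T -> S;
  homeo_cont : continuous homeo_fun;
  homeo_inv_cont : continuous homeo_inv;
  homeoK : cancel homeo_fun homeo_inv;
  homeo_invK : cancel homeo_inv homeo_fun
}.

Definition is_cantor_space (X : topologicalType) : Prop :=
  inhabited (homeo X cantor_space).

Definition selfhomeo (X : topologicalType) : Type := homeo X X.

Section SelfHomeoGroup.
Context {X : topologicalType}.
Implicit Types g h : selfhomeo X.

Lemma selfhomeo_eq g h : homeo_fun g =1 homeo_fun h -> g = h.
Proof.
case: g => f f' cf cf' fK f'K; case: h => k k' ck ck' kK k'K /= /funext fk.
subst k; have fk' : f' = k' by apply/funext => x; rewrite -{1}(k'K x) fK.
by subst k'; congr Homeo; exact: Prop_irrelevance.
Qed.

Definition selfhomeo_one : selfhomeo X :=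
  @Homeo X X id id (fun=> cvg_id) (fun=> cvg_id) (fun=> erefl) (fun=> erefl).

Definition selfhomeo_inverse g : selfhomeo X :=
  Homeo (@homeo_inv_cont _ _ g) (@homeo_cont _ _ g)
        (@homeo_invK _ _ g) (@homeoK _ _ g).

Lemma selfhomeo_mul_cont g h : continuous (g \o h).
Proof.
by move=> x; apply: continuous_comp; [exact: homeo_cont|exact: homeo_cont].
Qed.

Lemma selfhomeo_mul_inv_cont g h : continuous (homeo_inv h \o homeo_inv g).
Proof.
by move=> x; apply: continuous_comp; exact: homeo_inv_cont.
Qed.

Definition selfhomeo_mul g h : selfhomeo X :=
  @Homeo X X (g \o h) (homeo_inv h \o homeo_inv g)
    (@selfhomeo_mul_cont g h) (@selfhomeo_mul_inv_cont g h)
    (can_comp (@homeoK _ _ g) (@homeoK _ _ h))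
    (can_comp (@homeo_invK _ _ h) (@homeo_invK _ _ g)).

HB.instance Definition _ := gen_eqMixin (selfhomeo X).
HB.instance Definition _ := gen_choiceMixin (selfhomeo X).

Fact selfhomeo_mulA : associative selfhomeo_mul.
Proof. by move=> f g h; exact: selfhomeo_eq. Qed.
Fact selfhomeo_mul1g : left_id selfhomeo_one selfhomeo_mul.
Proof. by move=> g; exact: selfhomeo_eq. Qed.
Fact selfhomeo_mulg1 : right_id selfhomeo_one selfhomeo_mul.
Proof. by move=> g; exact: selfhomeo_eq. Qed.
Fact selfhomeo_mulVg :
  left_inverse selfhomeo_one selfhomeo_inverse selfhomeo_mul.
Proof. by move=> g; apply: selfhomeo_eq => x /=; rewrite homeoK. Qed.
Fact selfhomeo_mulgV :
  right_inverse selfhomeo_one selfhomeo_inverse selfhomeo_mul.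
Proof. by move=> g; apply: selfhomeo_eq => x /=; rewrite homeo_invK. Qed.

HB.instance Definition _ := isGroup.Build (selfhomeo X)
  selfhomeo_mulA selfhomeo_mul1g selfhomeo_mulg1
  selfhomeo_mulVg selfhomeo_mulgV.

Definition setwise_stab (A : set X) : set (selfhomeo X) :=
  [set g | homeo_fun g @` A = A].

Definition basic_subgroup : set (set (selfhomeo X)) :=
  [set V | exists n (A : 'I_n -> set X),
     (forall i, clopen (A i)) /\ V = \bigcap_i setwise_stab (A i)].

(* The basic subgroups are stable under conjugation, so using their left
   translates or their right translates gives the same topology. *)
Definition selfhomeo_open (U : set (selfhomeo X)) : Prop :=
  forall g, U g ->
    exists2 V, basic_subgroup V & forall v, V v -> U (g * v)%g.

Fact selfhomeo_openT : selfhomeo_open setT.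
Proof.
move=> g _; exists (\bigcap_(i : 'I_0) setwise_stab set0) => //.
by exists 0, (fun=> set0); split=> // -[].
Qed.

Fact selfhomeo_openI U V :
  selfhomeo_open U -> selfhomeo_open V -> selfhomeo_open (U `&` V).
Proof.
move=> oU oV g [/oU[_ [m [A [cA ->]] AU]] /oV[_ [n [B [cB ->]] BV]]].
pose C (i : 'I_(m + n)) := match fintype.split i with inl j => A j | inr j => B j end.
exists (\bigcap_i setwise_stab (C i)).
  by exists (m + n)%N, C; split=> // i; rewrite /C; case: fintype.split.
move=> v Cv; split; [apply: AU|apply: BV] => i _.
  by have := Cv (lshift n i) I; rewrite /C (unsplitK (inl i)).
by have := Cv (rshift m i) I; rewrite /C (unsplitK (inr i)).
Qed.

Fact selfhomeo_open_bigcup (I : Type) (U : I -> set (selfhomeo X)) :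
  (forall i, selfhomeo_open (U i)) -> selfhomeo_open (\bigcup_i U i).
Proof.
move=> oU g [i _ /oU[V bV VU]]; exists V => // v Vv.
by exists i => //; exact: VU.
Qed.

HB.instance Definition _ := isOpenTopological.Build (selfhomeo X)
  selfhomeo_openT selfhomeo_openI selfhomeo_open_bigcup.

Lemma selfhomeo_openE (U : set (selfhomeo X)) : open U = selfhomeo_open U.
Proof. by []. Qed.

Lemma setwise_stabM (A : set X) g h :
  setwise_stab A g -> setwise_stab A h -> setwise_stab A (g * h)%g.
Proof.
rewrite /setwise_stab /= => gA hA.
by rewrite -{2}gA -{2}hA -(image_comp (homeo_fun h) (homeo_fun g)).
Qed.

Lemma basic_subgroup_open V : basic_subgroup V -> open V.
Proof.
move=> bV; rewrite selfhomeo_openE => g Vg; exists V => // v Vv.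
case: bV Vg Vv => n [A [_ ->]] Vg Vv i _.
by apply: setwise_stabM; [exact: Vg|exact: Vv].
Qed.

Lemma nbhs_selfhomeo1 (U : set (selfhomeo X)) :
  nbhs (1%g : selfhomeo X) U <-> exists2 V, basic_subgroup V & V `<=` U.
Proof.
rewrite nbhsE; split=> [[B [+ B1] BU]|[V bV VU]].
  rewrite selfhomeo_openE => /(_ _ B1)[V bV VB]; exists V => // v Vv.
  by apply: BU; rewrite -(mul1g v); exact: VB.
exists V => //; split; first exact: basic_subgroup_open.
by case: bV => n [A [_ ->]] i _; rewrite /setwise_stab /= image_id.
Qed.

End SelfHomeoGroup.

Section GSets.
Context {X : topologicalType}.
Local Notation G := (selfhomeo X).

Record gset := GSet {
  gcarrier :> Type;
  gact : G -> gcarrier -> gcarrier;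
  gact1 : forall x, gact 1%g x = x;
  gactM : forall g h x, gact (g * h)%g x = gact g (gact h x);
  gsmooth : forall x, open [set g : G | gact g x = x]
}.

Definition gorbit (S : gset) (x : S) : set S := range (fun g => gact g x).

Record fin_gset := FinGSet {
  fin_gset_gset :> gset;
  gfinitary : finite_set (range (@gorbit fin_gset_gset))
}.

Definition gtransitive (S : gset) : Prop :=
  (exists x : S, True) /\ forall x y : S, exists g : G, gact g x = y.

Record trans_gset := TransGSet {
  trans_gset_fin :> fin_gset;
  gtrans : gtransitive trans_gset_fin
}.

Record gmap (S T : gset) := GMap {
  gmap_fun :> S -> T;
  gmap_equivariant : forall g x, gmap_fun (gact g x) = gact g (gmap_fun x)
}.

Fact gcomp_equivariant (S T U : gset) (g : gmap T U) (f : gmap S T) h x :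
  (g \o f) (gact h x) = gact h ((g \o f) x).
Proof. by rewrite /= !gmap_equivariant. Qed.

Definition gcomp (S T U : gset) (g : gmap T U) (f : gmap S T) : gmap S U :=
  GMap (gcomp_equivariant g f).

Definition giso (S T : gset) (f : gmap S T) : Prop :=
  exists g : gmap T S, cancel f g /\ cancel g f.

(* Base change is only meant up to isomorphism: the square is cartesian when
   the map from S' to the fiber product of S and T' over T is bijective. *)
Definition gcartesian (S S' T T' : gset)
    (f : gmap S T) (b : gmap T' T) (f' : gmap S' T') (b' : gmap S' S) : Prop :=
  (forall x', f (b' x') = b (f' x')) /\
  (forall x y', f x = b y' -> exists! x', b' x' = x /\ f' x' = y').

Definition gstable (S : gset) (A : set S) : Prop :=
  forall g x, A x -> A (gact g x).

Section Sub.
Context {S : fin_gset} {A : set S} (sA : gstable A).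

Definition gsub_act (g : G) (x : {x : S | A x}) : {x : S | A x} :=
  exist _ (gact g (sval x)) (sA g (svalP x)).

Fact gsub_act1 x : gsub_act 1%g x = x.
Proof. by case: x => x Ax; apply: eq_exist; exact: gact1. Qed.

Fact gsub_actM g h x : gsub_act (g * h)%g x = gsub_act g (gsub_act h x).
Proof. by case: x => x Ax; apply: eq_exist; exact: gactM. Qed.

Fact gsub_smooth x : open [set g : G | gsub_act g x = x].
Proof.
case: x => x Ax.
rewrite (_ : [set g | _] = [set g | gact g x = x]); first exact: gsmooth.
by apply/seteqP; split=> g /= => [/(congr1 sval)|gx]; last exact: eq_exist.
Qed.

Definition gsub_gset : gset := GSet gsub_act1 gsub_actM gsub_smooth.

Fact gsub_finitary : finite_set (range (@gorbit gsub_gset)).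
Proof.
apply: (sub_finite_set _ (finite_image (fun O => sval @^-1` O) (@gfinitary S))).
move=> _ [x _ <-]; exists (gorbit (sval x)); first by exists (sval x).
apply/seteqP; split=> y /= [g _ gx]; exists g => //.
  by case: y gx => y Ay /= gx; exact: eq_exist.
by rewrite -gx.
Qed.

Definition gsub : fin_gset := FinGSet gsub_finitary.

Fact grestrict_equivariant (T : gset) (f : gmap S T) g (x : gsub) :
  f (sval (gact g x)) = gact g (f (sval x)).
Proof. exact: gmap_equivariant. Qed.

Definition grestrict (T : gset) (f : gmap S T) : gmap gsub T :=
  GMap (grestrict_equivariant f).

End Sub.

Fact gpoint_smooth (x : unit) : open [set g : G | x = x].
Proof. by rewrite (_ : [set g | _] = setT); [exact: openT|apply/seteqP]. Qed.

Definition gpoint_gset : gset :=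
  @GSet unit (fun=> id) (fun=> erefl) (fun _ _ _ => erefl) gpoint_smooth.

Fact gpoint_finitary : finite_set (range (@gorbit gpoint_gset)).
Proof.
by apply: (sub_finite_set _ (finite_set1 (gorbit (tt : gpoint_gset)))) =>
  _ [[] _ <-].
Qed.

Definition gpoint_fin : fin_gset := FinGSet gpoint_finitary.

Fact gpoint_trans : gtransitive gpoint_fin.
Proof. by split=> [|[] []]; [exists tt|exists 1%g]. Qed.

Definition gpoint : trans_gset := TransGSet gpoint_trans.

Definition gto_point (S : gset) : gmap S gpoint :=
  @GMap S gpoint (fun=> tt) (fun _ _ => erefl).

End GSets.

Arguments gset X : clear implicits.
Arguments fin_gset X : clear implicits.
Arguments trans_gset X : clear implicits.
Arguments gpoint X : clear implicits.

(* The codomain T of a measured map is transitive, in particular nonempty;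
   the domain S may be empty. *)
Record gmeasure (X : topologicalType) (k : comPzRingType) := GMeasure {
  gmeas :> forall (S : fin_gset X) (T : trans_gset X), gmap S T -> k;
  gmeas_iso : forall (S : fin_gset X) (T : trans_gset X) (f : gmap S T),
    giso f -> gmeas f = 1%R;
  gmeas_add : forall (S : fin_gset X) (T : trans_gset X) (f : gmap S T)
      (A B : set S) (sA : gstable A) (sB : gstable B),
    A `|` B = setT -> A `&` B = set0 ->
    gmeas f = (gmeas (grestrict sA f) + gmeas (grestrict sB f))%R;
  gmeas_comp : forall (S : fin_gset X) (T U : trans_gset X)
      (f : gmap S T) (g : gmap T U),
    gmeas (gcomp g f) = (gmeas g * gmeas f)%R;
  gmeas_base_change : forall (S S' : fin_gset X) (T T' : trans_gset X)
      (f : gmap S T) (b : gmap T' T) (f' : gmap S' T') (b' : gmap S' S),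
    gcartesian f b f' b' -> gmeas f' = gmeas f
}.

Definition gmeas_set (X : topologicalType) (k : comPzRingType)
    (mu : gmeasure X k) (S : fin_gset X) : k :=
  mu S (gpoint X) (gto_point S).

Definition gregular (X : topologicalType) (k : comUnitRingType)
    (mu : gmeasure X k) : Prop :=
  forall (S T : trans_gset X) (f : gmap S T), mu S T f \is a GRing.unit.

(* Here [n] is 'I_n, that is, {0, ..., n-1} rather than {1, ..., n}. *)
Record csurj (X : topologicalType) (n : nat) := CSurj {
  csurj_fun :> X -> discrete_topology 'I_n;
  csurj_cont : continuous csurj_fun;
  csurj_surj : forall i, exists x, csurj_fun x = i
}.

Section Surjections.
Context {X : topologicalType} {n : nat}.
Implicit Types (f : csurj X n) (g : selfhomeo X).

Lemma csurj_eq f f' : f =1 f' -> f = f'.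
Proof.
case: f f' => [f cf sf] [f' cf' sf'] /= /funext ff'; subst f'.
by congr CSurj; exact: Prop_irrelevance.
Qed.

Lemma csurj_fiber_clopen f (i : 'I_n) : clopen (f @^-1` [set i]).
Proof.
apply: preimage_clopen; last exact: csurj_cont.
by split; [exact: discrete_open|exact: discrete_closed].
Qed.

Fact csurj_act_cont g f :
  continuous ((f : X -> discrete_topology 'I_n) \o homeo_inv g).
Proof.
by move=> x; apply: continuous_comp; [exact: homeo_inv_cont|exact: csurj_cont].
Qed.

Fact csurj_act_surj g f i : exists x, (f \o homeo_inv g) x = i.
Proof.
by have [x fx] := csurj_surj f i; exists (g x); rewrite /= homeoK.
Qed.

Definition csurj_act g f : csurj X n :=
  CSurj (@csurj_act_cont g f) (csurj_act_surj g f).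

Fact csurj_act1 f : csurj_act 1%g f = f.
Proof. exact: csurj_eq. Qed.

Fact csurj_actM g h f : csurj_act (g * h)%g f = csurj_act g (csurj_act h f).
Proof. exact: csurj_eq. Qed.

Fact csurj_smooth f : open [set g | csurj_act g f = f].
Proof.
rewrite selfhomeo_openE => g /= gf.
exists (\bigcap_i setwise_stab (f @^-1` [set i])).
  exists n, (fun i => f @^-1` [set i]); split=> // i.
  exact: csurj_fiber_clopen.
move=> v Vv; apply: csurj_eq => x; rewrite -[in RHS]gf /=.
set y := homeo_inv g x.
have [z /= fz vz] : (homeo_fun v @` (f @^-1` [set f y])) y by rewrite (Vv _ I).
by rewrite -{1}vz homeoK.
Qed.

Definition csurj_gset : gset X := GSet csurj_act1 csurj_actM csurj_smooth.

End Surjections.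
Arguments csurj_gset X n : clear implicits.

Section CantorClopen.
Implicit Types (x y z : cantor_space) (A : set cantor_space) (N : nat).

Definition agree N x y : Prop := forall i, (i < N)%N -> x i = y i.

Definition ccons (b : bool) x : cantor_space :=
  fun i => if i is j.+1 then x j else b.

Definition ctail x : cantor_space := fun i => x i.+1.

Lemma ccons_tail x : ccons (x 0%N) (ctail x) = x.
Proof. by apply/funext => -[]. Qed.

Lemma agree_refl N x : agree N x x.
Proof. by []. Qed.

Lemma agree_leq M N x y : (N <= M)%N -> agree M x y -> agree N x y.
Proof. by move=> NM xy i iN; apply: xy; exact: leq_trans NM. Qed.

Lemma agree_ccons N b x y : agree N x y -> agree N.+1 (ccons b x) (ccons b y).
Proof. by move=> xy [|i] //= iN; exact: xy. Qed.

Lemma nbhs_agree N x : nbhs x (agree N x).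
Proof.
have H (i : 'I_N) : nbhs x [set y : cantor_space | x i = y i].
  apply: (@proj_continuous nat (fun=> bool) i x [set b | x i = b]).
  by rewrite nbhs_principalE; apply/principal_filterP.
have := filter_forall (nbhs_filter x) H; apply: filterS => y xy i iN.
exact: (xy (Ordinal iN)).
Qed.

Lemma nbhs_agreeP x A : nbhs x A -> exists N, agree N x `<=` A.
Proof.
move=> xA; apply: contrapT => /forallNP noN.
have /choice[y yP] : forall N, exists y, agree N x y /\ ~ A y.
  by move=> N; have /existsNP[y /not_implyP yP] := noN N; exists y.
have yx : y @ \oo --> x.
  apply/cvg_sup => i U [_ [[W] oW <-] Wx WU].
  apply: (filterS WU); rewrite nbhs_simpl; exists i.+1 => // N /= iN.
  by rewrite /= -((yP N).1 i iN).
by have [N _ /(_ N (leqnn N))] := yx _ xA; exact: (yP N).2.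
Qed.

Definition cylinder_cont (u : cantor_space -> cantor_space) : Prop :=
  forall x N, exists M, forall y, agree M x y -> agree N (u x) (u y).

Lemma cylinder_cont_continuous u : cylinder_cont u -> continuous u.
Proof.
move=> cu x A /nbhs_agreeP[N NA]; have [M MN] := cu x N.
by apply: filterS (nbhs_agree M x) => y /MN /NA.
Qed.

Lemma cylinder_cont_id : cylinder_cont id.
Proof. by move=> x N; exists N. Qed.

Lemma cylinder_cont_comp u v :
  cylinder_cont u -> cylinder_cont v -> cylinder_cont (u \o v).
Proof.
move=> cu cv x N; have [M MN] := cu (v x) N; have [L LM] := cv x M.
by exists L => y /LM /MN.
Qed.

Lemma cylinder_cont_tail : cylinder_cont ctail.
Proof. by move=> x N; exists N.+1 => y xy i iN; exact: xy. Qed.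

Lemma cylinder_cont_ccons b : cylinder_cont (ccons b).
Proof.
by move=> x N; exists N => y /(@agree_ccons _ b); exact: agree_leq.
Qed.

Lemma cylinder_cont_head (u : bool -> cantor_space -> cantor_space) :
  (forall b, cylinder_cont (u b)) -> cylinder_cont (fun x => u (x 0%N) x).
Proof.
move=> cu x N; have [M MN] := cu (x 0%N) x N; exists M.+1 => y xy.
by rewrite -(xy 0%N)//; apply: MN; exact: agree_leq xy.
Qed.

(* Membership in A only depends on the first N coordinates. *)
Definition has_depth N A : Prop := forall x y, agree N x y -> A x -> A y.

Lemma clopen_depth A : clopen A -> exists N, has_depth N A.
Proof.
move=> [oA cA]; have /compact_near_coveringP cC := cantor_space_compact.
have [x _|N _ /(_ N (leqnn N)) NA] :=
    cC nat \oo (fun N x => forall y, agree N x y -> A x -> A y) _; last first.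
  by exists N => x y; exact: NA.
have [Ax|nAx] := pselect (A x).
  have /nbhs_agreeP[M MA] : nbhs x A by exact: open_nbhs_nbhs.
  exists (agree M x, [set N | (M <= N)%N]) => /=.
    by split; [exact: nbhs_agree|exists M].
  move=> [z N] [/= xz MN] y zy _; apply: MA => i iM.
  by rewrite xz// zy//; exact: leq_trans MN.
have /nbhs_agreeP[M MA] : nbhs x (~` A).
  by apply: open_nbhs_nbhs; split=> //; exact: closed_openC.
exists (agree M x, [set N | (M <= N)%N]) => /=.
  by split; [exact: nbhs_agree|exists M].
by move=> [z N] [/= /MA nAz _] y _ /nAz.
Qed.

(* u is a homeomorphism onto A, whose inverse is extended to a map v on the
   whole Cantor space. *)
Definition cantor_equiv A : Prop :=
  exists u v : cantor_space -> cantor_space,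
    [/\ cylinder_cont u, cylinder_cont v, forall x, A (u x),
        cancel u v & forall y, A y -> u (v y) = y].

Lemma depth_cantor_equiv N A : has_depth N A -> A !=set0 -> cantor_equiv A.
Proof.
elim: N A => [|N IH] A dA [a Aa].
  exists id, id; split=> // [||x]; try exact: cylinder_cont_id.
  exact: dA Aa.
pose B b := [set x | A (ccons b x)].
have dB b : has_depth N (B b).
  by move=> x y xy; apply: dA; exact: agree_ccons.
have [[b B0]|/forallNP Bn0] := pselect (exists b, B b = set0).
  have An y : A y -> y 0%N = ~~ b.
    move=> Ay; have [yb|] := eqVneq (y 0%N) b; last by case: (y 0%N); case: (b).
    have : B b (ctail y) by rewrite /B /= -yb ccons_tail.
    by rewrite B0.
  have [|u [v [cu cv Bu uK vK]]] := IH (B (~~ b)) (dB _).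
    by exists (ctail a); rewrite /B /= -(An _ Aa) ccons_tail.
  exists (ccons (~~ b) \o u), (v \o ctail); split.
  - exact: cylinder_cont_comp (cylinder_cont_ccons _) cu.
  - exact: cylinder_cont_comp cv cylinder_cont_tail.
  - by move=> x; exact: Bu.
  - exact: uK.
  - move=> y Ay /=; have := ccons_tail y; rewrite (An _ Ay) => yE.
    by rewrite vK// /B /= yE.
have /choice[u /choice[v uvP]] : forall b, cantor_equiv (B b).
  by move=> b; apply: IH (dB b) _; apply/set0P/eqP; exact: Bn0.
exists (fun x => ccons (x 0%N) (u (x 0%N) (ctail x))).
exists (fun y => ccons (y 0%N) (v (y 0%N) (ctail y))); split.
- apply: (@cylinder_cont_head (fun b x => ccons b (u b (ctail x)))) => b.
  have [cu _ _ _ _] := uvP b.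
  exact: cylinder_cont_comp (cylinder_cont_ccons b)
    (cylinder_cont_comp cu cylinder_cont_tail).
- apply: (@cylinder_cont_head (fun b x => ccons b (v b (ctail x)))) => b.
  have [_ cv _ _ _] := uvP b.
  exact: cylinder_cont_comp (cylinder_cont_ccons b)
    (cylinder_cont_comp cv cylinder_cont_tail).
- by move=> x; have [_ _ Bu _ _] := uvP (x 0%N); exact: Bu.
- move=> x /=; have [_ _ _ uK _] := uvP (x 0%N).
  by rewrite -[in RHS](ccons_tail x); congr ccons; exact: uK.
- move=> y Ay /=; have [_ _ _ _ vK] := uvP (y 0%N).
  apply: etrans (ccons_tail y); congr ccons; apply: vK.
  by rewrite /B /= ccons_tail.
Qed.

End CantorClopen.

Section CsurjFinite.
Context {X : topologicalType} {n : nat}.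

Lemma csurj_glue (f : csurj X n) (u : 'I_n -> X -> X) :
  (forall i, continuous (u i)) -> continuous (fun x => u (f x) x).
Proof.
move=> cu x A /cu uA.
have fx : nbhs x (f @^-1` [set f x]).
  by apply: open_nbhs_nbhs; split=> //; exact: (csurj_fiber_clopen f _).1.
by apply: filterS (filterI fx uA) => y [/= ->].
Qed.

Lemma csurj_transitive (hX : is_cantor_space X) (f f' : csurj X n) :
  exists g : selfhomeo X, csurj_act g f = f'.
Proof.
have [h] := hX.
pose A (k : csurj X n) i : set cantor_space := homeo_inv h @^-1` (k @^-1` [set i]).
have eqA k i : cantor_equiv (A k i).
  have /clopen_depth[N dN] : clopen (A k i).
    exact: preimage_clopen (csurj_fiber_clopen k i) (@homeo_inv_cont _ _ h).
  apply: depth_cantor_equiv dN _.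
  by have [x kx] := csurj_surj k i; exists (h x); rewrite /A /= homeoK.
have /choice[u /choice[v uvP]] := eqA f.
have /choice[u' /choice[v' uvP']] := eqA f'.
pose p i x := homeo_inv h (u' i (v i (h x))).
pose q i x := homeo_inv h (u i (v' i (h x))).
have cpq (a b : cantor_space -> cantor_space) :
    cylinder_cont a -> cylinder_cont b ->
    continuous (fun x => homeo_inv h (a (b (h x)))).
  move=> ca cb x.
  apply: (@continuous_comp _ _ _ h (homeo_inv h \o (a \o b))).
    exact: homeo_cont.
  apply: continuous_comp; last exact: homeo_inv_cont.
  exact: (cylinder_cont_continuous (cylinder_cont_comp ca cb)).
have cp : continuous (fun x => p (f x) x).
  apply: csurj_glue => i; have [_ cv _ _ _] := uvP i.
  by have [cu' _ _ _ _] := uvP' i; exact: cpq cu' cv.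
have cq : continuous (fun x => q (f' x) x).
  apply: csurj_glue => i; have [cu _ _ _ _] := uvP i.
  by have [_ cv' _ _ _] := uvP' i; exact: cpq cu cv'.
have f'p x : f' (p (f x) x) = f x.
  by have [_ _ Au' _ _] := uvP' (f x); exact: Au'.
have fq x : f (q (f' x) x) = f' x.
  by have [_ _ Au _ _] := uvP (f' x); exact: Au.
have pK : cancel (fun x => p (f x) x) (fun x => q (f' x) x).
  move=> x; rewrite f'p /q /p homeo_invK.
  have [_ _ _ uK' _] := uvP' (f x); have [_ _ _ _ vK] := uvP (f x).
  by rewrite uK' vK ?homeoK// /A /= homeoK.
have qK : cancel (fun x => q (f' x) x) (fun x => p (f x) x).
  move=> x; rewrite fq /q /p homeo_invK.
  have [_ _ _ uK _] := uvP (f' x); have [_ _ _ _ vK'] := uvP' (f' x).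
  by rewrite uK vK' ?homeoK// /A /= homeoK.
by exists (Homeo cp cq pK qK); exact: csurj_eq.
Qed.

Fact csurj_finitary (hX : is_cantor_space X) :
  finite_set (range (@gorbit X (csurj_gset X n))).
Proof.
have [[f _]|nf] := pselect (exists f : csurj X n, True).
  apply: (sub_finite_set _ (finite_set1 [set: csurj X n])) => _ [f' _ <-].
  apply/seteqP; split=> // f'' _.
  by have [g gf] := csurj_transitive hX f' f''; exists g.
apply: (sub_finite_set _ (finite_set0 _)) => O [f _ _].
by apply: nf; exists f.
Qed.

End CsurjFinite.

Definition csurj_fin (X : topologicalType) (hX : is_cantor_space X) (n : nat) :
  fin_gset X := FinGSet (@csurj_finitary X n hX).

(* Main.v *)
Require Import Defs.
From mathcomp Require Import all_boot all_order all_algebra perm ring.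
From mathcomp Require Import all_classical topology cantor.

(** Write G for the group of self-homeomorphisms of X and V_x for the stabilizer
of a labelling x in X(n). Both measures come from one construction, with a
parameter w equal to -2 or -1 and value w^(n-1) on X(n).

Structure of transitive G-sets. Let U be the stabilizer of a point s. Being open,
it contains some V_x; take n minimal. If some u in U carries the partition of x
to a different partition, then a block of u x meets two blocks i and j of x;
V_x and V_(u x) both lie in U, and together they move the boundary between i and
j freely, so that U contains the stabilizer of the partition in which i and j are
merged ([merge_supports]), against minimality. So U permutes the blocks of x
([tight_exists]): x is tight for U, and U / V_x is a finite group, identified with
the set [moves x U] of maps of labels. The partition is determined by U
([tight_factor]), so that the weight w^(n-1) / |U / V_x| of U is well defined.

Existence. The mass of a finitary G-set is the sum of the weights of its orbits,
and the measure of S -> T is mass S / mass T. Only invariance under base change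
needs work. Covering all G-sets in sight by sets X(m), it reduces to the fiber
product of X(m) and X(n) over X(l). An orbit of pairs (x, y) is determined by the
relation formed by the pairs of labels that occur together ([joint_eq]), and a
pair with relation r generates a copy of X(|r|). So base change amounts to the
identity [sum_ample]: the sum of w^|r| over the relations r contained in the fiber
product of two surjections A -> C and B -> C, and projecting onto A and onto B, is
w^(|A| + |B| - |C|). This is where w matters: inclusion-exclusion expresses the
sum through the numbers e = (1 + w)^k - 1, and the identity holds because e^2 = w e
for all k, as e takes the values 0 and w only.

Uniqueness. Let phi : X(n) -> S be given by a tight labelling of a point of S.
Each orbit of the kernel pair of phi projects isomorphically to X(n), so that every
measure of phi is the number of these orbits ([gmeas_tight_cover]). By
multiplicativity and regularity the values on the sets X(n) then determine the
measure of every transitive S, hence of every map of transitive G-sets, and by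
additivity every value. *)

Set Implicit Arguments.
Unset Strict Implicit.
Unset Printing Implicit Defensive.

Import GRing.Theory Num.Theory.

Local Open Scope classical_set_scope.

(** * Counting ample relations *)

Section Ample.
Import boot.fintype boot.finset.
Local Open Scope ring_scope.
Context (R : comPzRingType).

Lemma sum_subsets_expr (A : finType) (L : {set A}) (x : R) :
  \sum_(J : {set A} | J \subset L) x ^+ #|J| = (1 + x) ^+ #|L|.
Proof.
symmetry; rewrite -prodr_const big_mkcond /=.
transitivity (\prod_i ((if i \in L then x else 0) + 1)).
  by apply: eq_bigr => i _; case: ifP; rewrite ?add0r // addrC.
rewrite bigA_distr [RHS]big_mkcond /=; apply: eq_bigr => J _; case: ifP => [JL|/negbT JL].
  rewrite -big_mkcond -prodr_const; apply: eq_bigr => i iJ.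
  by rewrite (subsetP JL).
have [i iJ iL] := subsetPn JL.
by rewrite (bigD1 i) //= iJ (negPf iL) mul0r.
Qed.

Context (A C : finType) (a : A -> C) (w : R).

Definition fib (c : C) : {set A} := [set i | a i == c].

(** The sum of w^|s| over the nonempty subsets s of a fiber that avoid L. *)
Definition nonempty_sum (L : {set A}) (c : C) : R := (1 + w) ^+ #|fib c :\: L| - 1.

(** The relations of the definition [ample] below, written by columns: f j is the
    set of all i related to j. *)
Definition covering_columns (B : finType) (b : B -> C) (f : {ffun B -> {set A}}) : bool :=
  (f \in family (fun j => [pred s : {set A} | (s \subset fib (b j)) && (s != set0)])) &&
  (\bigcup_j f j == setT).

(** Inclusion-exclusion on the set L of elements of A that are missed by all
    columns. Once L is fixed, the columns are independent of each other. *)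
Lemma sum_columns (B : finType) (b : B -> C) :
  \sum_(f | covering_columns b f) \prod_j w ^+ #|f j| =
  \sum_(L : {set A}) (-1) ^+ #|L| * \prod_j nonempty_sum L (b j).
Proof.
pose Q j := [pred s : {set A} | (s \subset fib (b j)) && (s != set0)].
have eE L j : nonempty_sum L (b j) =
    \sum_(s : {set A} | Q j s && [disjoint s & L]) w ^+ #|s|.
  rewrite /nonempty_sum -sum_subsets_expr (bigD1 (set0 : {set A})) ?sub0set //=.
  rewrite cards0 expr0 [1 + _]addrC addrK.
  apply: eq_bigl => s; rewrite subsetD /=.
  by case: (s \subset _) => //=; rewrite andbC.
transitivity (\sum_(L : {set A}) \sum_(f : {ffun B -> {set A}} |
    (f \in family Q) && [disjoint L & \bigcup_j f j]) (-1) ^+ #|L| * \prod_j w ^+ #|f j|);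
    last first.
  apply: eq_bigr => L _.
  under eq_bigr => j _ do rewrite eE.
  rewrite (bigA_distr_big_dep (fun j s => Q j s && [disjoint s & L])) mulr_sumr.
  apply: eq_bigl => f; apply/andP/familyP => [[/familyP fQ /bigcup_disjointP fL] j|H].
    by rewrite unfold_in /= -[X in X && _]/(f j \in Q j) fQ disjoint_sym fL.
  split; first by apply/familyP => j; have := H j; rewrite unfold_in /= => /andP[].
  apply/bigcup_disjointP => j _; rewrite disjoint_sym.
  by have := H j; rewrite unfold_in /= => /andP[].
rewrite (exchange_big_dep (fun f : {ffun B -> {set A}} => f \in family Q)) /=; last first.
  by move=> L f _ /andP[].
rewrite big_mkcondr /=; apply: eq_bigr => f fQ.
rewrite -mulr_suml (eq_bigl (fun L : {set A} => L \subset ~: \bigcup_j f j)); last first.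
  by move=> L; rewrite fQ /= disjoints_subset.
rewrite sum_subsets_expr subrr expr0n cards_eq0 -setCT (inj_eq (can_inj (@setCK _))).
by case: eqP => _; rewrite ?mul1r ?mul0r.
Qed.

Context (ew : forall k, ((1 + w) ^+ k - 1) ^+ 2 = w * ((1 + w) ^+ k - 1)).
Context (asurj : forall c, exists i, a i = c).

(** Since e^2 = w e, the factors belonging to the same c collapse to a power of w
    and a single factor; so b only enters through the cardinal of B. *)
Lemma prod_nonempty_sum (B : finType) (b : B -> C) (L : {set A}) :
  (forall c, exists j, b j = c) ->
  w ^+ #|C| * \prod_j nonempty_sum L (b j) = w ^+ #|B| * \prod_c nonempty_sum L c.
Proof.
move=> bsurj.
have eX k c : w * nonempty_sum L c ^+ k.+1 = w ^+ k.+1 * nonempty_sum L c.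
  elim: k => // k IH; rewrite exprS mulrCA IH mulrCA -expr2 ew.
  by rewrite mulrA -exprSr.
transitivity (\prod_c (w * nonempty_sum L c ^+ #|[pred j | b j == c]|)).
  rewrite big_split /= prodr_const; congr (_ * _).
  rewrite (partition_big b predT) //=; apply: eq_bigr => c _.
  rewrite -prodr_const; apply: eq_big => [j|j /eqP->] //.
transitivity (\prod_c (w ^+ #|[pred j | b j == c]| * nonempty_sum L c)).
  apply: eq_bigr => c _; have [j bj] := bsurj c.
  have : (0 < #|[pred j | b j == c]|)%N by apply/card_gt0P; exists j; rewrite inE bj.
  by case: #|_| => // k _; exact: eX.
rewrite big_split /= prodrXr; congr (_ ^+ _ * _).
rewrite -[RHS]sum1_card (partition_big b predT) //=; apply: eq_bigr => c _.
by rewrite -sum1_card.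
Qed.

(** For B = C the columns are disjoint, and covering A forces each of them to be
    the whole fiber. *)
Lemma sum_columns_id : \sum_(f | covering_columns id f) \prod_j w ^+ #|f j| = w ^+ #|A|.
Proof.
rewrite (big_pred1 [ffun c => fib c]) => [|f].
  rewrite prodrXr; congr (_ ^+ _).
  rewrite -[RHS]sum1_card (partition_big a predT) //=; apply: eq_bigr => c _.
  by rewrite ffunE -sum1_card; apply: eq_bigl => i; rewrite inE.
rewrite /=; apply/andP/eqP => [[/familyP fQ /eqP fT]|->].
  apply/ffunP => c; rewrite ffunE; apply/eqP; rewrite eqEsubset.
  have /andP[-> _] := fQ c; apply/subsetP => i; rewrite inE => /eqP ic.
  have : i \in \bigcup_j f j by rewrite fT inE.
  case/bigcupP => j _ ij; have /andP[/subsetP/(_ i ij) + _] := fQ j.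
  by rewrite inE ic => /eqP ->.
split.
  apply/familyP => c; rewrite ffunE unfold_in /= subxx /=.
  by apply/set0Pn; have [i ic] := asurj c; exists i; rewrite inE ic.
rewrite eqEsubset subsetT; apply/subsetP => i _; apply/bigcupP; exists (a i) => //.
by rewrite ffunE inE.
Qed.

Definition ample (B : finType) (b : B -> C) (r : {set A * B}) : bool :=
  [&& [forall i, exists j, (i, j) \in r], [forall j, exists i, (i, j) \in r]
    & [forall ij in r, a ij.1 == b ij.2]].

(** By [prod_nonempty_sum] the inclusion-exclusion formulas for b and for the
    identity of C are proportional, and the latter is known. *)
Lemma sum_ample (B : finType) (b : B -> C) : (forall c, exists j, b j = c) ->
  w ^+ #|C| * \sum_(r | ample b r) w ^+ #|r| = w ^+ (#|A| + #|B|).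
Proof.
move=> bsurj.
pose rel_of (f : {ffun B -> {set A}}) : {set A * B} := [set ij | ij.1 \in f ij.2].
pose col_of (r : {set A * B}) := [ffun j : B => [set i : A | (i, j) \in r]].
have relK : cancel rel_of col_of.
  by move=> f; apply/ffunP => j; rewrite ffunE; apply/setP => i; rewrite !inE.
have colK : cancel col_of rel_of.
  by move=> r; apply/setP => -[i j]; rewrite inE /= ffunE inE.
have -> : \sum_(r | ample b r) w ^+ #|r| = \sum_(f | covering_columns b f) \prod_j w ^+ #|f j|.
  rewrite (reindex rel_of); last by exists col_of => ? _.
  apply: eq_big => [f|f _]; last first.
    rewrite prodrXr; congr (_ ^+ _).
    rewrite -[LHS]sum1_card (partition_big snd predT) //=; apply: eq_bigr => j _.
    rewrite -sum1_card (reindex_onto (fun i => (i, j)) fst) /=; last first.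
      by move=> [i k] /= /andP[_ /eqP ->].
    by apply: eq_bigl => i; rewrite !inE !eqxx !andbT.
  apply/and3P/andP => [[/forallP fi /forallP fj /forallP fij]|[/familyP fQ /eqP fT]].
    split.
      apply/familyP => j; rewrite unfold_in /=; apply/andP; split.
        apply/subsetP => i ij; rewrite inE.
        by have /implyP := fij (i, j); apply; rewrite inE.
      by apply/set0Pn; have /existsP[i] := fj j; rewrite inE => ij; exists i.
    rewrite eqEsubset subsetT; apply/subsetP => i _; apply/bigcupP.
    by have /existsP[j] := fi i; rewrite inE => ij; exists j.
  split; apply/forallP.
  - move=> i; have : i \in \bigcup_j f j by rewrite fT inE.
    by case/bigcupP => j _ ij; apply/existsP; exists j; rewrite inE.
  - move=> j; have /andP[_ /set0Pn[i ij]] := fQ j.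
    by apply/existsP; exists i; rewrite inE.
  - move=> [i j]; apply/implyP; rewrite inE /= => ij.
    by have /andP[/subsetP/(_ i ij) + _] := fQ j; rewrite inE.
rewrite sum_columns mulr_sumr exprD -sum_columns_id sum_columns mulr_suml.
by apply: eq_bigr => L _; rewrite mulrCA prod_nonempty_sum // mulrCA [RHS]mulrC.
Qed.

End Ample.

(** * Locally constant labellings *)

(** The same map, with values in the ordinals rather than in their discrete
    topological copy. *)
Definition lab (X : topologicalType) (n : nat) (x : csurj X n) : X -> 'I_n := x.
Arguments lab : simpl never.

Section Labellings.
Context {X : topologicalType}.
Implicit Types (g : selfhomeo X).

Definition loc_const (I : Type) (h : X -> I) : Prop :=
  forall p, nbhs p [set q | h q = h p].

Lemma loc_const_comp (I J : Type) (F : I -> J) (h : X -> I) :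
  loc_const h -> loc_const (F \o h).
Proof. by move=> ch p; apply: filterS (ch p) => q /= ->. Qed.

Lemma loc_const_pair (I J : Type) (h : X -> I) (k : X -> J) :
  loc_const h -> loc_const k -> loc_const (fun p => (h p, k p)).
Proof. by move=> ch ck p; apply: filterS2 (ch p) (ck p) => q /= -> ->. Qed.

Lemma loc_const_lab n (x : csurj X n) : loc_const (lab x).
Proof.
move=> p; apply: open_nbhs_nbhs; split=> //.
exact: (csurj_fiber_clopen x (lab x p)).1.
Qed.

Lemma loc_const_csurj n (h : X -> 'I_n) :
  loc_const h -> (forall i, exists p, h p = i) ->
  exists x : csurj X n, lab x = h.
Proof.
move=> ch sh.
have ch' : continuous (h : X -> discrete_topology 'I_n).
  move=> p A; rewrite nbhs_simpl /= nbhs_principalE => /principal_filterP Ap.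
  by apply: filterS (ch p) => q /= hq; rewrite /preimage /= hq.
by exists (CSurj ch' sh).
Qed.

Lemma lab_act n g (x : csurj X n) p : lab (csurj_act g x) p = lab x (homeo_inv g p).
Proof. by []. Qed.

Lemma lab_inj n (x y : csurj X n) : lab x =1 lab y -> x = y.
Proof. exact: csurj_eq. Qed.

Context (hX : is_cantor_space X).

Lemma cantor_point : exists p : X, True.
Proof. by have [h] := hX; exists (homeo_inv h (fun=> true)). Qed.

(** The fibers of h and h' indexed by the same value are nonempty clopen sets,
    hence homeomorphic: this is the transitivity of G on labellings, for arbitrary
    finite sets of labels. Every homeomorphism needed below comes from here. *)
Lemma loc_const_transitive (I : finType) (h h' : X -> I) :
  loc_const h -> loc_const h' ->
  (forall i, (exists p, h p = i) <-> (exists p, h' p = i)) ->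
  exists g : selfhomeo X, forall p, h (homeo_inv g p) = h' p.
Proof.
move=> ch ch' hh'; have [p0 _] := cantor_point.
pose R := [set i : I | `[< exists p, h p = i >]].
have hR p : h p \in R by rewrite inE; apply/asboolP; exists p.
have h'R p : h' p \in R by rewrite inE; apply/asboolP/hh'; exists p.
pose e := enum_rank_in (hR p0).
have sh k : exists p, e (h p) = k.
  have := enum_valP k; rewrite inE => /asboolP[p hp].
  by exists p; rewrite hp /e enum_valK_in.
have sh' k : exists p, e (h' p) = k.
  have := enum_valP k; rewrite inE => /asboolP/hh'[p hp].
  by exists p; rewrite hp /e enum_valK_in.
have [x xE] := loc_const_csurj (loc_const_comp e ch) sh.
have [x' x'E] := loc_const_csurj (loc_const_comp e ch') sh'.
have [g gx] := csurj_transitive hX x x'.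
exists g => p; have := lab_act g x p; rewrite gx xE x'E /= => /(congr1 enum_val).
by rewrite !enum_rankK_in.
Qed.

(** X has no isolated point: a coordinate of the Cantor set splits the fiber of h
    through p. *)
Lemma loc_const_split (I : Type) (h : X -> I) (p : X) : loc_const h ->
  exists d : X -> bool, loc_const d /\ exists2 q, h q = h p & d q = ~~ d p.
Proof.
move=> ch; have [c] := hX.
have := @homeo_inv_cont _ _ c (c p) [set q | h q = h p].
rewrite homeoK => /(_ (ch p)) /nbhs_agreeP[N sN].
exists (fun q => homeo_fun c q N); split.
  move=> q; have H : nbhs q (homeo_fun c @^-1` agree N.+1 (c q)).
    exact: (@homeo_cont _ _ c q _ (nbhs_agree N.+1 (c q))).
  by apply: filterS H => q' /(_ N (ltnSn N)) /= ->.
pose y : cantor_space := fun i => (i == N) (+) homeo_fun c p i.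
exists (homeo_inv c y); last by rewrite homeo_invK /y eqxx.
by apply: sN => i iN; rewrite /y (ltn_eqF iN).
Qed.

Lemma csurj_exists n : exists x : csurj X n.+1, True.
Proof.
elim: n => [|n [x _]].
  have [p0 _] := cantor_point.
  have [||x _] := @loc_const_csurj 1 (fun=> ord0); last by exists x.
    by move=> p; exact: nearW.
  by move=> i; exists p0; rewrite [i]ord1.
have [p0 _] := cantor_point.
have [d [cd [q xq dq]]] := loc_const_split p0 (@loc_const_lab _ x).
pose F (t : 'I_n.+1 * bool) : 'I_n.+2 :=
  if (t.1 == lab x p0) && (t.2 == d q) then ord_max else widen_ord (leqnSn _) t.1.
have [||y _] := @loc_const_csurj _ (F \o (fun p => (lab x p, d p))).
- by apply: loc_const_comp; apply: loc_const_pair cd; exact: loc_const_lab.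
- move=> i; have [i_lt|] := ltnP i n.+1; last first.
    move=> ni; exists q; rewrite /F /= xq !eqxx; apply/val_inj => /=.
    by apply/eqP; rewrite eqn_leq ni -ltnS ltn_ord.
  have [p xp] := csurj_surj x (Ordinal i_lt).
  have [pp|pp] := boolP ((lab x p == lab x p0) && (d p == d q)).
    exists p0; rewrite /F /= eqxx dq; case: (d p0) => //=;
    apply/val_inj => /=; case/andP: pp => /eqP <- _; exact: (congr1 val xp).
  by exists p; rewrite /F /= (negPf pp); apply/val_inj => /=; exact: (congr1 val xp).
- by exists y.
Qed.

End Labellings.

(** * Tight labellings of point stabilizers *)

Section Supports.
Context {X : topologicalType} (hX : is_cantor_space X).
Local Notation G := (selfhomeo X).
Implicit Types (g : G) (U : set G).

Definition gstab (S : gset X) (s : S) : set G := [set g | gact g s = s].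

(** Here csurj_act g x = x says that g fixes every block of the partition x, so the
    condition is that U contains V_x. *)
Definition supports n (x : csurj X n) U : Prop :=
  forall g, csurj_act g x = x -> U g.

(** Every element of U maps blocks of x to blocks of x; c is the induced map of
    labels. *)
Definition permutes n (x : csurj X n) U : Prop :=
  forall g, U g -> exists c : {ffun 'I_n -> 'I_n},
    forall p, lab (csurj_act g x) p = c (lab x p).

Definition tight n (x : csurj X n) U : Prop := supports x U /\ permutes x U.

Lemma gact_inv (S : gset X) g (s : S) : gact (g^-1)%g (gact g s) = s.
Proof. by rewrite -gactM mulVg gact1. Qed.

(** X(n) is the orbit G / V_x, so it maps to the orbit of s. *)
Lemma csurj_orbit_map n (x : csurj X n) (S : gset X) (s : S) :
  supports x (gstab s) ->
  exists f : gmap (csurj_gset X n) S, f x = s.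
Proof.
move=> xs.
have /choice[c cE] : forall y, exists g, csurj_act g x = y.
  by move=> y; exact: csurj_transitive.
have cs g : gact (c (csurj_act g x)) s = gact g s.
  apply: (can_inj (@gact_inv S (g^-1)%g)); rewrite -!gactM mulVg gact1.
  by apply: xs; rewrite csurj_actM cE -csurj_actM mulVg csurj_act1.
have fE g (y : csurj_gset X n) : gact (c (gact g y)) s = gact g (gact (c y) s).
  by have := cs (g * c y)%g; rewrite csurj_actM cE gactM.
exists (@GMap X (csurj_gset X n) S (fun y => gact (c y) s) fE) => /=.
by have := cs 1%g; rewrite csurj_act1 gact1.
Qed.

Definition labels (I : finType) (h : X -> I) : {set I} :=
  [set i | `[< exists p, h p = i >]]%SET.

Lemma labelsP (I : finType) (h : X -> I) i :
  i \in labels h <-> exists p, h p = i.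
Proof. by rewrite inE; split=> /asboolP. Qed.

(** A locally constant map is a labelling by the values that it takes. *)
Lemma loc_const_factor (I : finType) (h : X -> I) (R : {set I}) :
  loc_const h -> (forall i, i \in R <-> exists p, h p = i) ->
  exists (z : csurj X #|R|) (e : 'I_#|R| -> I),
    injective e /\ forall p, h p = e (lab z p).
Proof.
move=> ch RE; have [p0 _] := cantor_point hX.
have hR p : h p \in R by apply/RE; exists p.
have [||z zE] := @loc_const_csurj X _ (enum_rank_in (hR p0) \o h).
- exact: loc_const_comp.
- move=> k; have /RE[p hp] := enum_valP k.
  by exists p; rewrite /= hp enum_valK_in.
exists z, enum_val; split; first exact: enum_val_inj.
by move=> p; rewrite zE /= enum_rankK_in.
Qed.

(** A neighborhood of the identity is given by finitely many clopen sets; their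
    joint indicator function is a labelling. *)
Lemma open_supports (S : gset X) (s : S) :
  exists n (x : csurj X n), supports x (gstab s).
Proof.
have := @gsmooth _ S s; rewrite selfhomeo_openE.
move=> /(_ 1%g (gact1 s))[_ [m [A [cA ->]] AS]].
pose h p := [ffun i => `[< A i p >]].
have ch : loc_const h.
  move=> p; have H i : nbhs p [set q | A i q <-> A i p].
    have [Ap|nAp] := pselect (A i p).
      have : nbhs p (A i) by apply: open_nbhs_nbhs; split=> //; exact: (cA i).1.
      by apply: filterS => q.
    have : nbhs p (~` A i).
      by apply: open_nbhs_nbhs; split=> //; exact/closed_openC/(cA i).2.
    by apply: filterS => q.
  have := filter_forall (nbhs_filter p) H; apply: filterS => q /= Hq.
  by apply/ffunP => i; rewrite !ffunE; exact: asbool_equiv_eq.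
have [z [e [ei hz]]] := loc_const_factor ch (labelsP h).
exists _, z => g gz; rewrite /gstab /= -(mul1g g); apply: AS => i _.
have hg p : h (homeo_inv g p) = h p.
  by rewrite !hz -lab_act gz.
have Ag p : A i (homeo_inv g p) <-> A i p.
  have /(congr1 (fun f : {ffun 'I_m -> bool} => f i)) := hg p.
  by rewrite !ffunE => E; split=> /asboolP; [rewrite E|rewrite -E] => /asboolP.
apply/seteqP; split=> [_ [p Ap <-]|p Ap].
  by apply/Ag; rewrite homeoK.
by exists (homeo_inv g p); [exact/Ag|rewrite homeo_invK].
Qed.

(** The block i of y is obtained from the block i of x by adding a part of the
    block j. *)
Definition relabels n (i j : 'I_n) (x y : csurj X n) : Prop :=
  forall p, lab x p = lab y p \/ (lab x p = j /\ lab y p = i).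

Definition in_pair n (i j k : 'I_n) := (k == i) || (k == j).

(** All pairs of distinct labellings in this relation form a single orbit of G, as
    the same pairs of labels occur together in each of them. *)
Lemma relabels_const n (i j : 'I_n) (S : gset X) (f : gmap (csurj_gset X n) S)
    (x x1 : csurj X n) :
  i != j -> relabels i j x x1 -> x <> x1 -> f x = f x1 ->
  forall y y1 : csurj X n, relabels i j y y1 -> f y = f y1.
Proof.
move=> ij xx1 nx fx y y1 yy1; have [->//|ny] := pselect (y = y1).
have rangeE (u v : csurj X n) : relabels i j u v -> u <> v -> forall kl : 'I_n * 'I_n,
    (exists p, (lab u p, lab v p) = kl) <-> (kl.1 = kl.2 \/ kl = (j, i)).
  move=> uv nuv [k l]; split=> [[p [<- <-]]|/=[<-|[-> ->]]].
  - by have [->|[-> ->]] := uv p; [left|right].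
  - have [kj|kj] := eqVneq k j.
      have [p vp] := csurj_surj v k; exists p; congr pair => //.
      have [->//|[_ vi]] := uv p.
      by case/eqP: ij; rewrite -vi -kj.
    have [p up] := csurj_surj u k; exists p; congr pair => //.
    have [<-//|[uj _]] := uv p.
    by case/eqP: kj; rewrite -uj.
  - apply: contrapT => /forallNP no; apply: nuv; apply: lab_inj => p.
    by have [//|[uj vi]] := uv p; case: (no p); rewrite uj vi.
have [g gE] := @loc_const_transitive X hX _ (fun p => (lab x p, lab x1 p))
  (fun p => (lab y p, lab y1 p))
  (loc_const_pair (loc_const_lab x) (loc_const_lab x1))
  (loc_const_pair (loc_const_lab y) (loc_const_lab y1))
  (fun kl => iff_trans (rangeE _ _ xx1 nx kl) (iff_sym (rangeE _ _ yy1 ny kl))).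
have <- : csurj_act g x = y by apply: lab_inj => p; case: (gE p).
have <- : csurj_act g x1 = y1 by apply: lab_inj => p; case: (gE p).
have := gmap_equivariant f g x; rewrite fx => ->.
exact: esym (gmap_equivariant f g x1).
Qed.

(** Any two labellings that agree up to the division of the union of the blocks i
    and j are connected by moves of the form [relabels]: shrink the block i of x
    to a1, enlarge it by the block i of y to a2, and shrink it to the block i of y.
    The point p, which a1 and a2 leave in the block j, makes these labellings
    surjective. *)
Lemma merge_const n (i j : 'I_n) (T : Type) (f : csurj X n -> T) :
  i != j ->
  (forall y y1, relabels i j y y1 -> f y = f y1) ->
  forall x y, (forall p, lab x p = lab y p \/ in_pair i j (lab x p) /\ in_pair i j (lab y p)) ->
  f x = f y.
Proof.
move=> ij fR x y xy.
have [p yp] : exists p, lab y p = j := csurj_surj y j.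
have [p0 xp0] : exists p, lab x p = i := csurj_surj x i.
have [d [cd [q0 xq0 dq0]]] := loc_const_split hX p0 (@loc_const_lab _ _ x).
pose F (t : 'I_n * bool) := (t.1 == i) && (t.2 == ~~ d p).
pose A u := F (lab x u, d u).
have [u0 Au0] : exists u, A u.
  have [dp|dp] := eqVneq (d p0) (~~ d p).
    by exists p0; rewrite /A /F /= xp0 dp !eqxx.
  exists q0; rewrite /A /F /= xq0 xp0 dq0 eqxx.
  by move: dp; case: (d p0); case: (d p).
have nAp : A p = false by rewrite /A /F /=; case: (d p); rewrite andbF.
pose F1 (t : 'I_n * bool) := if F t then i else if t.1 == i then j else t.1.
pose F2 (t : 'I_n * bool * 'I_n) :=
  if F t.1 || (t.2 == i) then i else if t.1.1 == i then j else t.1.1.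
have c1 : loc_const (fun u => (lab x u, d u)).
  by apply: loc_const_pair cd; exact: loc_const_lab.
have c2 : loc_const (fun u => (lab x u, d u, lab y u)).
  by apply: loc_const_pair => //; exact: loc_const_lab.
have xp : lab x p = i \/ lab x p = j.
  by have [->|[/orP[/eqP|/eqP]]] := xy p; auto.
have [|a1 a1E] := loc_const_csurj (loc_const_comp F1 c1).
  move=> k; have [->|ki] := eqVneq k i.
    by exists u0; rewrite /F1 /=; move: Au0; rewrite /A => ->.
  have [kj|kj] := eqVneq k j.
    exists p; rewrite /F1 /=; move: nAp; rewrite /A => -> /=.
    by case: xp => ->; rewrite ?eqxx ?[j == i]eq_sym ?(negPf ij).
  have [u xu] : exists u, lab x u = k := csurj_surj x k.
  by exists u; rewrite /F1 /F /= xu (negPf ki).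
have [|a2 a2E] := loc_const_csurj (loc_const_comp F2 c2).
  move=> k; have [->|ki] := eqVneq k i.
    by exists u0; rewrite /F2 /=; move: Au0; rewrite /A => ->.
  have [kj|kj] := eqVneq k j.
    exists p; rewrite /F2 /=; move: nAp; rewrite /A => -> /=.
    rewrite yp [j == i]eq_sym (negPf ij).
    by case: xp => ->; rewrite ?eqxx ?[j == i]eq_sym ?(negPf ij).
  have [u xu] : exists u, lab x u = k := csurj_surj x k.
  have yu : lab y u = k.
    by have [<-//|[/orP[]]] := xy u; rewrite xu ?(negPf ki) ?(negPf kj).
  by exists u; rewrite /F2 /F /= xu yu (negPf ki).
have xa1 : relabels i j a1 x.
  move=> u; rewrite a1E /= /F1 /F /=.
  have [->|] := eqVneq (lab x u) i; last by left.
  by case: (d u == ~~ d p) => /=; [left|right].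
have a1a2 : relabels i j a1 a2.
  move=> u; rewrite a1E a2E /= /F1 /F2 /=; case: (F _) => /=; first by left.
  have [yi|yi] := eqVneq (lab y u) i; last by left.
  right; split=> //; have [//|xi] := eqVneq (lab x u) i.
  by have [xyu|[/orP[xi'|/eqP//]]] := xy u; [rewrite xyu yi eqxx in xi|rewrite xi' in xi].
have ya2 : relabels i j y a2.
  move=> u; rewrite a2E /= /F2 /F /=.
  have [yi|yi] := eqVneq (lab y u) i; first by rewrite orbT; left.
  rewrite orbF; have [xi|xi] := eqVneq (lab x u) i => /=.
    have yj : lab y u = j.
      have [xyu|[_ /orP[yi'|/eqP//]]] := xy u; first by rewrite -xyu xi eqxx in yi.
      by rewrite yi' in yi.
    by rewrite yj; case: ifP; [right|left].
  left; have [//|[/orP[xi'|/eqP->]]] := xy u; first by rewrite xi' in xi.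
  by case/orP => [yi'|/eqP//]; rewrite yi' in yi.
by rewrite -(fR _ _ xa1) (fR _ _ a1a2) (fR _ _ ya2).
Qed.

(** The map f depends only on the labelling with i and j merged, which has fewer
    blocks. *)
Lemma merge_supports n (i j : 'I_n) (S : gset X) (f : gmap (csurj_gset X n) S)
    (x : csurj X n) :
  i != j ->
  (forall y y1 : csurj X n, relabels i j y y1 -> f y = f y1) ->
  exists2 m, (m < n)%N & exists z : csurj X m, supports z (gstab (f x)).
Proof.
move=> ij fR.
pose F k := if k == j then i else k.
have [z [e [ei zE]]] := loc_const_factor (loc_const_comp F (loc_const_lab x))
  (labelsP (F \o lab x)).
exists #|labels (F \o lab x)|.
  rewrite -[X in (_ < X)%N](card_ord n) -cardsT; apply: proper_card.
  apply/properP; split; first exact: finset.subsetT.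
  exists j => //; apply/negP => /labelsP[p] /=; rewrite /F.
  by case: eqVneq => [_ /eqP|/[swap] ->]; rewrite ?(negPf ij) ?eqxx.
exists z => g gz; rewrite /gstab /=.
have <- : f (csurj_act g x) = gact g (f x) := gmap_equivariant f g x.
apply: (merge_const ij fR) => p.
have : F (lab (csurj_act g x) p) = F (lab x p).
  by have := zE p; have := zE (homeo_inv g p); rewrite -!lab_act gz /= => -> ->.
rewrite /F /in_pair; case: eqVneq => [->|nj]; case: eqVneq => [->|nj'].
- by left.
- by move=> <-; right; rewrite !eqxx orbT.
- by move=> ->; right; rewrite !eqxx orbT.
- by left.
Qed.

(** A labelling with the least number of blocks among those supporting the
    stabilizer is tight, by the argument sketched at the top. *)
Lemma tight_exists (S : gset X) (s : S) :
  exists n (x : csurj X n), tight x (gstab s).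
Proof.
have exP : exists n, `[< exists x : csurj X n, supports x (gstab s) >].
  by have [n nP] := open_supports s; exists n; exact/asboolP.
case: (ex_minnP exP) => n /asboolP[x xs] minn.
exists n, x; split=> // u us.
have [f fx] := csurj_orbit_map xs.
set y := csurj_act u x.
have fy : f y = f x.
  by have := gmap_equivariant f u x; rewrite fx => ->; exact: us.
have [yx|] := pselect (forall p q, lab y p = lab y q -> lab x p = lab x q).
  have /choice[r rE] : forall i, exists k, forall p, lab y p = i -> lab x p = k.
    move=> i; have [q yq] : exists q, lab y q = i := csurj_surj y i.
    by exists (lab x q) => p yp; apply: yx; rewrite yp.
  have /choice[v vE] : forall i, exists p, lab x p = i by exact: csurj_surj.
  (* The partitions have the same number of blocks, so refinement is equality. *)
  have tK : cancel (fun i => lab y (v i)) r by move=> i; rewrite -(rE _ (v i)) ?vE.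
  have rK := canF_sym tK.
  exists [ffun i => lab y (v i)] => p.
  by rewrite ffunE (rE (lab y p) p) // rK.
case/existsNP => p /existsNP[q /not_implyP[ypq xpq]].
have ij : lab x p != lab x q by exact/eqP.
have ch : loc_const (fun t => (lab x t, lab y t)).
  by apply: loc_const_pair; exact: loc_const_lab.
(* Move to the block i of x a part of its block j lying in the block of y that
   meets both: no pair of labels of (x, y) appears or disappears, so some g fixing
   y achieves this. *)
have [d [cd [q' hq' dq']]] := loc_const_split hX q ch.
case: hq' => xq' yq'.
pose F (t : 'I_n * 'I_n * bool) :=
  if (t.1 == (lab x q, lab y q)) && (t.2 == ~~ d q) then lab x p else t.1.1.
have [|x1 x1E] := loc_const_csurj (loc_const_comp F (loc_const_pair ch cd)).
  move=> k; have [kj|kj] := eqVneq k (lab x q).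
    by exists q; rewrite /F /= eqxx; case: (d q).
  have [t xt] : exists t, lab x t = k := csurj_surj x k.
  by exists t; rewrite /F /= xpair_eqE xt (negPf kj).
have xx1 : relabels (lab x p) (lab x q) x x1.
  move=> t; rewrite x1E /= /F /=; case: ifP => [|_]; last by left.
  by case/andP => /eqP[-> _] _; right.
have nx : x <> x1.
  move=> /(congr1 (fun x => lab x q')) /=; rewrite x1E /= /F /= xq' yq' dq' !eqxx /=.
  by move/esym/eqP; rewrite (negPf ij).
have [g gE] : exists g : G, forall t, (lab x (homeo_inv g t), lab y (homeo_inv g t)) =
                                      (lab x1 t, lab y t).
  apply: (loc_const_transitive hX ch).
    by apply: loc_const_pair; exact: loc_const_lab.
  move=> kl; split=> [[t <-]|[t <-]].
    have [tq|tq] := eqVneq (lab x t, lab y t) (lab x q, lab y q).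
      by exists q; rewrite x1E /= /F /= eqxx tq; case: (d q).
    by exists t; rewrite x1E /= /F /= (negPf tq).
  rewrite x1E /= /F /=; case: ifP => [|_]; last by exists t.
  by case/andP => /eqP[_ ->] _; exists p; rewrite ypq.
have gx : csurj_act g x = x1 by apply: lab_inj => t; case: (gE t).
have gy : csurj_act g y = y by apply: lab_inj => t; case: (gE t).
have fx1 : f x = f x1.
  have -> : f x1 = gact g (f x) by rewrite -gx; exact: gmap_equivariant.
  have := gmap_equivariant f g y; rewrite -fy => <-.
  by congr (gmap_fun f _); exact: esym gy.
have [m mn [z zs]] := merge_supports x ij (relabels_const ij xx1 nx fx1).
have /minn : `[< exists x : csurj X m, supports x (gstab s) >].
  by apply/asboolP; exists z; rewrite -fx.
by rewrite leqNgt mn.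
Qed.

End Supports.

(** * The weight of a subgroup *)

(** Two ways P and P' of encoding the elements of U, the first being coarser. It
    compares orders of finite quotients of U without forming the quotients. *)
Lemma leq_card_rel (T : Type) (U : set T) (D D' : finType)
    (P : T -> D -> Prop) (P' : T -> D' -> Prop) (A : {set D}) (A' : {set D'}) :
  (forall c, c \in A <-> exists2 g, U g & P g c) ->
  (forall c, c \in A' <-> exists2 g, U g & P' g c) ->
  (forall g, U g -> exists c, P' g c) ->
  (forall g h c d c' d', U g -> U h -> P g c -> P h d -> P' g c' -> P' h d' ->
     c' = d' -> c = d) ->
  (#|A| <= #|A'|)%N.
Proof.
move=> AE A'E P'ex inj.
have [->|[c0 /AE[g0 U0 _]]] := set_0Vmem A; first by rewrite cards0.
have [d0 _] := P'ex g0 U0.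
have /choice[f fE] : forall c : D, exists c' : D', c \in A ->
    exists g, [/\ U g, P g c & P' g c'].
  move=> c; have [/AE[g Ug Pgc]|_] := boolP (c \in A); last by exists d0.
  by have [c' P'gc'] := P'ex g Ug; exists c' => _; exists g.
rewrite -(@card_in_imset _ _ f); last first.
  by move=> c d /fE[g [Ug Pc P'c]] /fE[h [Uh Pd P'd]]; exact: inj Pc Pd P'c P'd.
apply/subset_leq_card/fintype.subsetP => _ /imsetP[c /fE[g [Ug _ P'g]] ->].
by apply/A'E; exists g.
Qed.

Section Weight.
Context {X : topologicalType} (hX : is_cantor_space X).
Local Notation G := (selfhomeo X).
Implicit Types (g : G) (U : set G).

Lemma lab_surj n (x : csurj X n) i : exists p, lab x p = i.
Proof. exact: csurj_surj. Qed.

(** For x tight for U this is the finite group U / V_x. *)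
Definition moves n (x : csurj X n) U : {set {ffun 'I_n -> 'I_n}} :=
  [set c : {ffun 'I_n -> 'I_n} |
    `[< exists2 g, U g & forall p, lab (csurj_act g x) p = c (lab x p) >]]%SET.

Lemma movesP n (x : csurj X n) U c :
  c \in moves x U <->
  exists2 g, U g & forall p, lab (csurj_act g x) p = c (lab x p).
Proof. by rewrite inE; split=> /asboolP. Qed.

(** Suppose that y takes different values at p and q in the same block of x. Split
    the set where x and y agree with their values at p in two pieces, and let g
    exchange one of them with a piece at q. Then g fixes x, so lies in U, but it
    maps the block of y through p to a set that is not a block of y. *)
Lemma tight_factor n (x : csurj X n) m (y : csurj X m) U :
  supports x U -> permutes y U -> exists f, forall p, lab y p = f (lab x p).
Proof.
move=> xU Uy.
suff xy p q : lab x p = lab x q -> lab y p = lab y q.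
  have /choice[s sE] := lab_surj x.
  by exists (fun i => lab y (s i)) => p; apply: xy; rewrite sE.
move=> xpq; apply/eqP/negP => /negP ypq.
have ch : loc_const (fun t => (lab x t, lab y t)).
  by apply: loc_const_pair; exact: loc_const_lab.
have [d [cd [p' [xp' yp'] dp']]] := loc_const_split hX p ch.
pose h t := (lab x t, lab y t, d t).
have ch' : loc_const h by exact: loc_const_pair.
pose t := tperm (h p') (h q).
have t1 k : (t k).1.1 = k.1.1.
  by rewrite /t; case: tpermP => // ->; rewrite /h /= xp' xpq.
have [|g gE] := loc_const_transitive hX ch' (loc_const_comp t ch').
  have tr k : (exists u, h u = k) -> exists u, h u = t k.
    by case=> u <-; rewrite /t; case: tpermP => _; [exists q|exists p'|exists u].
  move=> k; split=> [/tr[u hu]|[u hu]].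
    by exists u; rewrite /= hu /t tpermK.
  by have := tr (h u); rewrite -hu /=; apply; exists u.
have [|c cE] := Uy g.
  apply: xU; apply: lab_inj => u; rewrite lab_act.
  by have /(congr1 (fun k => k.1.1)) := gE u; rewrite /= t1.
have tp : t (h p) = h p.
  rewrite /t tpermD //; rewrite /h !xpair_eqE ?dp'; first by case: (d p); rewrite andbF.
  by rewrite [lab y q == _]eq_sym (negPf ypq) andbF.
have := cE p; rewrite lab_act.
have /(congr1 (fun k => k.1.2)) := gE p; rewrite /= tp /= => ->.
have := cE p'; rewrite lab_act.
have /(congr1 (fun k => k.1.2)) := gE p'; rewrite /= /t tpermL /= => ->.
by rewrite yp' => <- /eqP; rewrite (negPf ypq).
Qed.

Lemma csurj_act_eq n (x : csurj X n) g h c d :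
  (forall p, lab (csurj_act g x) p = c (lab x p)) ->
  (forall p, lab (csurj_act h x) p = d (lab x p)) ->
  csurj_act g x = csurj_act h x <-> c =1 d.
Proof.
move=> gc hd; split=> [gh i|cd].
  by have [p <-] := lab_surj x i; rewrite -gc gh hd.
by apply: lab_inj => p; rewrite gc hd cd.
Qed.

Context (K : numFieldType) (w : K).

Definition weight_at n (x : csurj X n) U : K :=
  (w ^+ n.-1 / #|moves x U|%:R)%R.

(** By [weight_at_uniq] the set has at most one element. *)
Definition weight U : K :=
  xget 0%R [set r | exists n (x : csurj X n), tight x U /\ weight_at x U = r].

(** Two labellings tight for U factor through each other, so they are the same
    partition up to the names of the blocks. *)
Lemma weight_at_uniq n (x : csurj X n) m (y : csurj X m) U :
  tight x U -> tight y U -> weight_at x U = weight_at y U.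
Proof.
move=> [xU Ux] [yU Uy].
have [f fE] := tight_factor xU Uy; have [f' f'E] := tight_factor yU Ux.
have fK : cancel f f'.
  by move=> i; have [p <-] := lab_surj x i; rewrite -fE -f'E.
have f'K : cancel f' f.
  by move=> i; have [p <-] := lab_surj y i; rewrite -f'E -fE.
have nm : n = m by have := bij_eq_card (Bijective fK f'K); rewrite !card_ord.
have le k (u : csurj X k) l (v : csurj X l) (r : 'I_k -> 'I_l) :
    (forall p, lab v p = r (lab u p)) -> injective r -> permutes v U ->
    (#|moves u U| <= #|moves v U|)%N.
  move=> vr ri Uv; apply: (leq_card_rel (movesP u U) (movesP v U) Uv).
  move=> g h c d c' d' Ug Uh gc hd gc' hd' cd'; apply/ffunP.
  apply/(csurj_act_eq gc hd); apply: lab_inj => p; apply: ri.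
  by rewrite lab_act -vr -lab_act gc' cd' -hd' lab_act vr -lab_act.
rewrite /weight_at (_ : #|moves x U| = #|moves y U|) ?nm //.
by apply/eqP; rewrite eqn_leq (le _ _ _ _ f) ?(le _ _ _ _ f') //;
  [exact: can_inj f'K|exact: can_inj fK].
Qed.

Lemma weightE n (x : csurj X n) U : tight x U -> weight U = weight_at x U.
Proof.
move=> xU; rewrite /weight; case: xgetP => [r _ [m [y [yU <-]]]|/(_ (weight_at x U))].
  exact: weight_at_uniq.
by case; exists n, x.
Qed.

Lemma moves_gt0 n (x : csurj X n) U : U 1%g -> (0 < #|moves x U|)%N.
Proof.
move=> U1; apply/card_gt0P; exists [ffun i => i]; apply/movesP; exists 1%g => // p.
by rewrite csurj_act1 ffunE.
Qed.

Lemma tight_self n (x : csurj X n) :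
  tight x [set g | csurj_act g x = x].
Proof.
by split=> // g ->; exists [ffun i => i] => p; rewrite ffunE.
Qed.

Lemma weight_csurj n (x : csurj X n) :
  weight [set g | csurj_act g x = x] = (w ^+ n.-1)%R.
Proof.
rewrite (weightE (tight_self x)) /weight_at (_ : #|_| = 1%N) ?divr1 //.
apply/eqP/cards1P; exists [ffun i => i]; apply/setP => c; rewrite inE.
apply/idP/eqP => [/movesP[g gx gc]|->].
  apply/ffunP => i; rewrite ffunE; have [p <-] := lab_surj x i.
  by rewrite -gc gx.
by apply/movesP; exists 1%g => [|p]; rewrite /= ?csurj_act1 ?ffunE.
Qed.

Lemma weight_setT : weight setT = 1%R.
Proof.
have [x _] := csurj_exists hX 0.
have o1 (i j : 'I_1) : i = j by rewrite (ord1 i) (ord1 j).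
have xT : tight x setT.
  split=> // g _; exists [ffun i => i] => p; exact: o1.
rewrite (weightE xT) /weight_at (_ : #|_| = 1%N) ?divr1 //.
apply/eqP/cards1P; exists [ffun i => i]; apply/setP => c; rewrite inE.
have -> : c = [ffun i => i] by apply/ffunP => i; exact: o1.
rewrite eqxx; apply/movesP; exists 1%g => // p; exact: o1.
Qed.

Lemma tight_act (S : gset X) (s : S) n (x : csurj X n) g :
  tight x (gstab s) -> tight (csurj_act g x) (gstab (gact g s)).
Proof.
move=> [xs sx]; have cj h : gstab (gact g s) h -> gstab s (g^-1 * h * g)%g.
  by rewrite /gstab /= !gactM => ->; rewrite gact_inv.
split=> h.
  move=> hx; have : gstab s (g^-1 * h * g)%g.
    by apply: xs; rewrite !csurj_actM hx -csurj_actM mulVg csurj_act1.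
  rewrite /gstab /= !gactM => /(congr1 (gact g)).
  by rewrite -[LHS]gactM mulgV gact1.
move=> /cj/sx[c cE]; exists c => p.
rewrite (lab_act g x) -cE -lab_act -!csurj_actM.
by rewrite !mulgA mulgV mul1g.
Qed.

Lemma moves_act (S : gset X) (s : S) n (x : csurj X n) g :
  moves (csurj_act g x) (gstab (gact g s)) = moves x (gstab s).
Proof.
apply/setP => c; apply/idP/idP => /movesP[h hs hc]; apply/movesP.
  exists (g^-1 * h * g)%g.
    by move: hs; rewrite /gstab /= !gactM => ->; rewrite gact_inv.
  move=> p; rewrite !csurj_actM lab_act hc lab_act; congr (c (lab x _)).
  exact: (homeoK g p).
exists (g * h * g^-1)%g.
  by rewrite /gstab /= !gactM gact_inv hs.
by move=> p; rewrite -!csurj_actM mulgVK csurj_actM lab_act hc lab_act.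
Qed.

Lemma weight_act (S : gset X) (s : S) g :
  weight (gstab (gact g s)) = weight (gstab s).
Proof.
have [n [x xs]] := tight_exists hX s.
by rewrite (weightE xs) (weightE (tight_act g xs)) /weight_at moves_act.
Qed.

Lemma weight_neq0 (S : gset X) (s : S) : w != 0%R -> weight (gstab s) != 0%R.
Proof.
move=> w0; have [n [x xs]] := tight_exists hX s; rewrite (weightE xs).
have : (0 < #|moves x (gstab s)|)%N by apply: moves_gt0; exact: gact1.
by rewrite lt0n => m0; rewrite mulf_neq0 ?invr_neq0 ?expf_neq0 ?pnatr_eq0.
Qed.

End Weight.

(** * The mass of a G-set *)

Section Mass.
Context {X : topologicalType} (hX : is_cantor_space X).
Local Notation G := (selfhomeo X).
Context (K : numFieldType) (w : K).

(** r lists one representative for each orbit. *)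
Definition is_reps (S : gset X) (I : Type) (r : I -> S) : Prop :=
  (forall s, exists i g, gact g (r i) = s) /\
  (forall i j g, gact g (r i) = r j -> i = j).

Definition point_mass (S : gset X) (s : S) : K := weight w (gstab s).

(** The sum of the point masses over the orbits, which is independent of the choice
    of representatives by [sum_reps_uniq]. *)
Definition mass (S : gset X) : K :=
  xget 0%R [set m | exists n (r : 'I_n -> S),
    is_reps r /\ (\sum_i point_mass (r i))%R = m].

Lemma point_mass_act (S : gset X) (s : S) g : point_mass (gact g s) = point_mass s.
Proof. exact: weight_act. Qed.

Lemma sum_reps_uniq (S : gset X) (I J : finType) (r : I -> S) (r' : J -> S) :
  is_reps r -> is_reps r' ->
  (\sum_i point_mass (r i) = \sum_j point_mass (r' j))%R.
Proof.
move=> [rs ri] [r's r'i].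
have /choice[f fE] : forall i, exists j g, gact g (r' j) = r i.
  by move=> i; exact: r's.
have /choice[f' f'E] : forall j, exists i g, gact g (r i) = r' j.
  by move=> j; exact: rs.
have fK : cancel f f'.
  move=> i; have [g gE] := fE i; have [h hE] := f'E (f i).
  by apply: (ri _ _ (g * h)%g); rewrite gactM hE.
have f'K : cancel f' f.
  move=> i; have [g gE] := f'E i; have [h hE] := fE (f' i).
  by apply: (r'i _ _ (g * h)%g); rewrite gactM hE.
rewrite (reindex f'); last by exists f => ? _.
apply: eq_bigr => j _; have [g <-] := f'E j.
by rewrite point_mass_act.
Qed.

Lemma massE (S : gset X) (I : finType) (r : I -> S) :
  is_reps r -> mass S = (\sum_i point_mass (r i))%R.
Proof.
move=> rS; rewrite /mass; case: xgetP => [m _ [n [r' [r'S <-]]]|].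
  exact: sum_reps_uniq.
move=> /(_ (\sum_i point_mass (r i))%R); case.
exists #|I|, (fun k => r (enum_val k)); split.
  case: rS => rs ri; split=> [s|i j g /ri/enum_val_inj//].
  by have [i [g gE]] := rs s; exists (enum_rank i), g; rewrite enum_rankK.
rewrite [RHS](reindex_onto enum_val enum_rank) //= => [|i _]; last by rewrite enum_rankK.
by apply: eq_bigl => i; rewrite enum_valK eqxx.
Qed.

Lemma reps_exist (S : fin_gset X) : exists n (r : 'I_n -> S), is_reps r.
Proof.
have /finite_seqP[l lE] := gfinitary S.
have lP (k : 'I_(size (undup l))) : exists s : S, gorbit s = tnth (in_tuple (undup l)) k.
  have : range (@gorbit _ S) (tnth (in_tuple (undup l)) k).
    by rewrite lE /= -mem_undup mem_tnth.
  by case=> s _ <-; exists s.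
have /choice[r rE] := lP.
exists (size (undup l)), r; split=> [s|i j g gE].
  have : range (@gorbit _ S) (gorbit s) by exists s.
  rewrite lE /= -mem_undup => /(tnthP (in_tuple (undup l)))[k kE]; exists k.
  have : gorbit (r k) s by rewrite rE -kE; exists 1%g => //; exact: gact1.
  by case=> g _ gs; exists g.
apply: (tuple_uniqP (in_tuple (undup l)) (undup_uniq l)); rewrite -!rE -gE.
apply/seteqP; split=> _ [h _ <-].
  by exists (h * g^-1)%g; rewrite // gactM gact_inv.
by exists (h * g)%g; rewrite // gactM.
Qed.

Lemma mass_trans (S : gset X) (s : S) : gtransitive S -> mass S = point_mass s.
Proof.
move=> [_ tS]; rewrite (@massE S unit (fun=> s)); last first.
  by split=> [s'|[] []//]; have [g gs] := tS s s'; exists tt, g.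
by rewrite (big_pred1 tt) // => -[].
Qed.

End Mass.

(** * Base change *)

Section BaseChange.
Context {X : topologicalType} (hX : is_cantor_space X).
Local Notation G := (selfhomeo X).

Lemma csurj_gt0 n (x : csurj X n) : (0 < n)%N.
Proof.
by have [p _] := cantor_point hX; exact: leq_ltn_trans (leq0n _) (ltn_ord (lab x p)).
Qed.

(** The pairs of labels that occur together; a complete invariant of the orbit of
    the pair (x, y), by [joint_act] and [joint_eq]. *)
Definition joint a b (x : csurj X a) (y : csurj X b) : {set 'I_a * 'I_b} :=
  labels (fun p => (lab x p, lab y p)).

Lemma loc_const_joint a b (x : csurj X a) (y : csurj X b) :
  loc_const (fun p => (lab x p, lab y p)).
Proof. by apply: loc_const_pair; exact: loc_const_lab. Qed.

Lemma joint_act a b (x : csurj X a) (y : csurj X b) g :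
  joint (csurj_act g x) (csurj_act g y) = joint x y.
Proof.
apply/setP => ij; apply/idP/idP => /labelsP[p <-]; apply/labelsP.
  by exists (homeo_inv g p).
by exists (g p); rewrite !lab_act homeoK.
Qed.

Lemma joint_eq a b (x x' : csurj X a) (y y' : csurj X b) :
  joint x y = joint x' y' ->
  exists g, csurj_act g x = x' /\ csurj_act g y = y'.
Proof.
move=> xy; have [|g gE] := loc_const_transitive hX
    (@loc_const_joint _ _ x y) (@loc_const_joint _ _ x' y').
  by move=> ij; rewrite -!labelsP -/(joint x y) xy.
by exists g; split; apply: lab_inj => p; rewrite lab_act; case: (gE p).
Qed.

Lemma joint_ample a b (x : csurj X a) (y : csurj X b) :
  (forall i, exists j, (i, j) \in joint x y) /\
  (forall j, exists i, (i, j) \in joint x y).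
Proof.
split=> i; [have [p <-] := lab_surj x i|have [p <-] := lab_surj y i].
  by exists (lab y p); apply/labelsP; exists p.
by exists (lab x p); apply/labelsP; exists p.
Qed.

Lemma joint_exists a b (r : {set 'I_a * 'I_b}) : (0 < #|r|)%N ->
  (forall i, exists j, (i, j) \in r) -> (forall j, exists i, (i, j) \in r) ->
  exists (x : csurj X a) (y : csurj X b), joint x y = r.
Proof.
move=> r0 ri rj.
have [m rm] : exists m, #|r| = m.+1 by case: #|r| r0 => // m; exists m.
have [z _] := csurj_exists hX m.
pose h p := @enum_val _ (mem r) (cast_ord (esym rm) (lab z p)).
have hr p : h p \in r by exact: enum_valP.
have hs ij : ij \in r -> exists p, h p = ij.
  move=> ijr; have [p zp] := lab_surj z (cast_ord rm (enum_rank_in ijr ij)).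
  by exists p; rewrite /h zp cast_ordK enum_rankK_in.
have ch : loc_const h.
  exact: (loc_const_comp (fun k => @enum_val _ (mem r) (cast_ord (esym rm) k)) (loc_const_lab z)).
have [|x xE] := loc_const_csurj (loc_const_comp fst ch).
  by move=> i; have [j /hs[p hp]] := ri i; exists p; rewrite /= hp.
have [|y yE] := loc_const_csurj (loc_const_comp snd ch).
  by move=> j; have [i /hs[p hp]] := rj j; exists p; rewrite /= hp.
exists x, y; apply/setP => ij; apply/idP/idP => [/labelsP[p]|/hs[p hp]].
  by rewrite xE yE /= -surjective_pairing => <-.
by apply/labelsP; exists p; rewrite xE yE /= -surjective_pairing.
Qed.

Lemma gmap_csurj n (S : gset X) (f : gmap (csurj_gset X n) S) g (x x' : csurj X n) :
  csurj_act g x = x' -> gact g (f x) = f x'.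
Proof. by move=> <-; exact: esym (gmap_equivariant f g x). Qed.

Lemma tight_over n (x x' : csurj X n) (S : gset X) (f : gmap (csurj_gset X n) S) :
  tight x (gstab (f x)) -> tight x' (gstab (f x')).
Proof.
have [g gx] := csurj_transitive hX x x'.
by rewrite -(gmap_csurj f gx) -gx; exact: tight_act.
Qed.

Lemma moves_over n (x x' : csurj X n) (S : gset X) (f : gmap (csurj_gset X n) S) :
  moves x' (gstab (f x')) = moves x (gstab (f x)).
Proof.
have [g gx] := csurj_transitive hX x x'.
by rewrite -(gmap_csurj f gx) -gx; exact: moves_act.
Qed.

(** With [moves_fiber]: the fibers of a tight cover are the orbits of the finite
    group of label maps. *)
Lemma fiber_moves n (x x' : csurj X n) (S : gset X) (f : gmap (csurj_gset X n) S) :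
  tight x (gstab (f x)) -> f x' = f x ->
  exists2 c, c \in moves x (gstab (f x)) & forall p, lab x' p = c (lab x p).
Proof.
move=> [_ xp] ff; have [g gx] := csurj_transitive hX x x'.
have gs : gstab (f x) g.
  by rewrite /gstab /= (gmap_csurj f gx).
have [c cE] := xp _ gs; exists c; first by apply/movesP; exists g.
by move=> p; rewrite -cE gx.
Qed.

Lemma moves_fiber n (x : csurj X n) (S : gset X) (f : gmap (csurj_gset X n) S) c :
  c \in moves x (gstab (f x)) ->
  exists2 x' : csurj X n, f x' = f x & forall p, lab x' p = c (lab x p).
Proof.
case/movesP => g gs gc; exists (csurj_act g x) => //.
exact: etrans (gmap_equivariant f g x) gs.
Qed.

Section Square.
Context (S S' T T' : gset X) (f : gmap S T) (b : gmap T' T)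
  (f' : gmap S' T') (b' : gmap S' S) (cart : gcartesian f b f' b').
Context (m n : nat) (phi : gmap (csurj_gset X m) S) (psi : gmap (csurj_gset X n) T').
Context (phi_tight : forall x : csurj X m, tight x (gstab (phi x))).
Context (psi_tight : forall y : csurj X n, tight y (gstab (psi y))).
Context (K : numFieldType) (w : K).

(** S' is the fiber product of S and T', covered by pairs in X(m) x X(n). Here r is
    the relation of a pair lying over s'. *)
Definition over (s' : S') (r : {set 'I_m * 'I_n}) : Prop :=
  exists (x : csurj X m) (y : csurj X n),
    [/\ joint x y = r, phi x = b' s' & psi y = f' s'].

Lemma over_act g s' r : over s' r -> over (gact g s') r.
Proof.
move=> [x [y [xy xs ys]]]; exists (csurj_act g x), (csurj_act g y).
split; first by rewrite joint_act.
  by rewrite gmap_equivariant -xs; exact: esym (gmap_csurj phi (erefl _)).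
by rewrite gmap_equivariant -ys; exact: esym (gmap_csurj psi (erefl _)).
Qed.

Lemma cartP s1 s2 : b' s1 = b' s2 -> f' s1 = f' s2 -> s1 = s2.
Proof.
move=> bs fs; have [cc /(_ (b' s2) (f' s2) (cc _))[s [_ us]]] := cart.
by rewrite -(us s1) // (us s2).
Qed.

Lemma over_uniq s1 s2 r : over s1 r -> over s2 r -> exists g, gact g s1 = s2.
Proof.
move=> [x1 [y1 [xy1 xs1 ys1]]] [x2 [y2 [xy2 xs2 ys2]]].
have [|g [gx gy]] := @joint_eq _ _ x1 x2 y1 y2; first by rewrite xy1.
exists g; apply: cartP.
  by rewrite gmap_equivariant -xs1 -xs2 (gmap_csurj phi gx).
by rewrite gmap_equivariant -ys1 -ys2 (gmap_csurj psi gy).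
Qed.

Lemma gstab_pullback s' g :
  gstab (b' s') g -> gstab (f' s') g -> gstab s' g.
Proof. by move=> gb gf; apply: cartP; rewrite gmap_equivariant. Qed.

Lemma gstab_map (U V : gset X) (h : gmap U V) u g : gstab u g -> gstab (h u) g.
Proof. by rewrite /gstab /= -gmap_equivariant => ->. Qed.

(** The pairs of the fiber through (x, y) of the map to S' whose relation is r,
    encoded by the label maps carrying (x, y) to them. *)
Definition moves_to (x : csurj X m) (y : csurj X n) (r : {set 'I_m * 'I_n}) :
    {set {ffun 'I_m -> 'I_m} * {ffun 'I_n -> 'I_n}} :=
  [set cc : {ffun 'I_m -> 'I_m} * {ffun 'I_n -> 'I_n} |
    [&& cc.1 \in moves x (gstab (phi x)), cc.2 \in moves y (gstab (psi y))
      & labels (fun p => (cc.1 (lab x p), cc.2 (lab y p))) == r]]%SET.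

(** For a pair (x2, y2) over s' with relation r, let z be the labelling by the pairs
    of labels of x2 and y2, which has |r| blocks. It is tight for the stabilizer W
    of s', and W / V_z is in bijection with the pairs over s' with relation r, as
    these form an orbit of W. *)
Lemma point_mass_over s' (x1 : csurj X m) (y1 : csurj X n) r :
  phi x1 = b' s' -> psi y1 = f' s' -> over s' r ->
  (point_mass w s' * #|moves_to x1 y1 r|%:R = w ^+ #|r|.-1)%R.
Proof.
move=> xs1 ys1 [x2 [y2 [xy2 xs2 ys2]]].
set A := moves_to x1 y1 r.
have [z [e [ei ze]]] := loc_const_factor hX (@loc_const_joint _ _ x2 y2)
  (labelsP (fun p => (lab x2 p, lab y2 p))).
rewrite -/(joint x2 y2) in z e ei ze *.
have x2z p : lab x2 p = (e (lab z p)).1 by rewrite -ze.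
have y2z p : lab y2 p = (e (lab z p)).2 by rewrite -ze.
have xz g h : csurj_act g z = csurj_act h z <->
    csurj_act g x2 = csurj_act h x2 /\ csurj_act g y2 = csurj_act h y2.
  split=> [gh|[gx gy]].
    split; apply: lab_inj => p; rewrite !lab_act ?x2z ?y2z -!lab_act gh //.
  apply: lab_inj => p; apply: ei; rewrite !lab_act -!ze.
  by rewrite -!lab_act gx gy.
have [x2s x2p] := phi_tight x2; have [y2s y2p] := psi_tight y2.
rewrite xs2 ys2 in x2s x2p y2s y2p.
have zt : tight z (gstab s').
  split=> g.
    rewrite -[RHS]csurj_act1 => /xz[]; rewrite !csurj_act1.
    by move=> /x2s gb /y2s gf; exact: gstab_pullback.
  move=> gs; have [c cE] := x2p g (gstab_map b' gs).
  have [d dE] := y2p g (gstab_map f' gs).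
  have /choice[v vE] := lab_surj z.
  exists [ffun k => lab (csurj_act g z) (v k)] => p; rewrite ffunE; apply: ei.
  rewrite !lab_act -!ze -!lab_act cE dE cE dE.
  by rewrite !x2z !y2z vE.
rewrite /point_mass (weightE hX w zt) /weight_at -[in RHS]xy2.
suff -> : #|A| = #|moves z (gstab s')|.
  rewrite mulfVK // pnatr_eq0 -lt0n; apply: moves_gt0; exact: gact1.
pose P g (cc : {ffun 'I_m -> 'I_m} * {ffun 'I_n -> 'I_n}) :=
  (forall p, lab (csurj_act g x2) p = cc.1 (lab x1 p)) /\
  (forall p, lab (csurj_act g y2) p = cc.2 (lab y1 p)).
have AP cc : cc \in A <-> exists2 g, gstab s' g & P g cc.
  split.
    rewrite inE => /and3P[/moves_fiber[x3 xs3 x3E] /moves_fiber[y3 ys3 y3E] /eqP rE].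
    have [|g [gx gy]] := @joint_eq _ _ x2 x3 y2 y3.
      rewrite xy2 -rE; congr labels; apply/funext => p.
      by rewrite x3E y3E.
    exists g; last by split=> p; rewrite ?gx ?gy ?x3E ?y3E.
    apply: gstab_pullback.
      by rewrite /gstab /= -xs2 (gmap_csurj phi gx) xs3 xs1 xs2.
    by rewrite /gstab /= -ys2 (gmap_csurj psi gy) ys3 ys1 ys2.
  case: cc => c d [g gs [/= gc gd]]; rewrite inE; apply/and3P.
    have [g1 g1x] := csurj_transitive hX x1 x2.
    have [g2 g2y] := csurj_transitive hX y1 y2.
    split => /=; [apply/movesP|apply/movesP|].
      exists (g * g1)%g => [|p]; last by rewrite csurj_actM g1x.
      rewrite /gstab /= gactM (gmap_csurj phi g1x) xs2 xs1.
      exact: (gstab_map b' gs).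
      exists (g * g2)%g => [|p]; last by rewrite csurj_actM g2y.
      rewrite /gstab /= gactM (gmap_csurj psi g2y) ys2 ys1.
      exact: (gstab_map f' gs).
  rewrite -xy2 -(joint_act x2 y2 g); apply/eqP; congr labels; apply/funext => p /=.
  by rewrite gc gd.
have Pex g : gstab s' g -> exists cc, P g cc.
  move=> gs.
  have [g1 g1x] := csurj_transitive hX x1 x2.
  have [g2 g2y] := csurj_transitive hX y1 y2.
  have [|c cE] := (phi_tight x1).2 (g * g1)%g.
    rewrite /gstab /= gactM (gmap_csurj phi g1x) xs2 xs1.
    exact: (gstab_map b' gs).
  have [|d dE] := (psi_tight y1).2 (g * g2)%g.
    rewrite /gstab /= gactM (gmap_csurj psi g2y) ys2 ys1.
    exact: (gstab_map f' gs).
  by exists (c, d); split=> p /=; [rewrite -cE csurj_actM g1x|rewrite -dE csurj_actM g2y].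
have P'ex g : gstab s' g -> exists c : {ffun 'I_#|joint x2 y2| -> 'I_#|joint x2 y2|},
    forall p, lab (csurj_act g z) p = c (lab z p).
  exact: zt.2.
apply/eqP; rewrite eqn_leq; apply/andP; split.
  apply: (leq_card_rel AP (movesP z (gstab s')) P'ex).
  move=> g h [c d] [c' d'] k k' _ _ [/= gc gd] [/= hc hd] gk hk kk.
  have /xz[gx gy] : csurj_act g z = csurj_act h z by apply/(csurj_act_eq gk hk); rewrite kk.
  congr pair; apply/ffunP => i.
    by have [p <-] := lab_surj x1 i; rewrite -gc gx hc.
  by have [p <-] := lab_surj y1 i; rewrite -gd gy hd.
apply: (leq_card_rel (movesP z (gstab s')) AP Pex).
move=> g h k k' [c d] [c' d'] _ _ gk hk [/= gc gd] [/= hc hd] [cc dd].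
apply/ffunP; apply/(csurj_act_eq gk hk)/xz.
by split; apply: lab_inj => p; rewrite ?gc ?hc ?gd ?hd ?cc ?dd.
Qed.

Lemma moves_to_over s' (x1 : csurj X m) (y1 : csurj X n) r :
  phi x1 = b' s' -> psi y1 = f' s' -> (0 < #|moves_to x1 y1 r|)%N -> over s' r.
Proof.
move=> xs ys /card_gt0P[[c d]]; rewrite inE /=.
case/and3P => /moves_fiber[x xs1 xE] /moves_fiber[y ys1 yE] /eqP <-.
exists x, y; split; [|by rewrite xs1|by rewrite ys1].
by congr labels; apply/funext => p; rewrite xE yE.
Qed.

Lemma card_moves_to (x1 : csurj X m) (y1 : csurj X n) :
  (\sum_r #|moves_to x1 y1 r|)%N =
  (#|moves x1 (gstab (phi x1))| * #|moves y1 (gstab (psi y1))|)%N.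
Proof.
rewrite -cardsX -sum1_card.
rewrite (partition_big (fun cc : {ffun 'I_m -> 'I_m} * {ffun 'I_n -> 'I_n} =>
  labels (fun p => (cc.1 (lab x1 p), cc.2 (lab y1 p)))) predT) //=.
apply: eq_bigr => r _; rewrite -sum1_card; apply: eq_bigl => cc.
by rewrite !inE andbA.
Qed.

(** r is the relation of some pair in the fiber product of X(m) and X(n) over T. *)
Definition compatible (r : {set 'I_m * 'I_n}) : bool :=
  `[< exists (x : csurj X m) (y : csurj X n), joint x y = r /\ f (phi x) = b (psi y) >].

(** Double counting. For each k, the fiber over rep k of the covering by pairs has
    the cardinal of the product of the two groups; sorted by relations, its part
    with relation r contributes w^(|r| - 1) to the point mass times this cardinal.
    Each compatible r lies over exactly one k. *)
Lemma sum_point_mass_over (I : finType) (rep : I -> S') (x0 : csurj X m) (y0 : csurj X n) :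
  is_reps rep -> (forall t', exists y, psi y = t') ->
  ((\sum_(k | `[< exists g, gact g (phi x0) = b' (rep k) >]) point_mass w (rep k)) *
     (#|moves x0 (gstab (phi x0))| * #|moves y0 (gstab (psi y0))|)%:R =
   \sum_(r | compatible r) w ^+ #|r|.-1)%R.
Proof.
move=> [repS repI] psi_surj; rewrite mulr_suml.
transitivity (\sum_(k | `[< exists g, gact g (phi x0) = b' (rep k) >])
   \sum_(r | `[< over (rep k) r >]) w ^+ #|r|.-1)%R.
  apply: eq_bigr => k /asboolP[g gx0].
  pose x1 := csurj_act g x0.
  have x1k : phi x1 = b' (rep k) by rewrite -gx0 (gmap_csurj phi (erefl x1)).
  have [y1 y1k] := psi_surj (f' (rep k)).
  rewrite -(moves_over x0 x1) -(moves_over y0 y1) -card_moves_to natr_sum mulr_sumr.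
  rewrite [RHS]big_mkcond /=; apply: eq_bigr => r _; case: asboolP => [kr|nkr].
    exact: point_mass_over.
  have [/(moves_to_over x1k y1k)//|] := ltnP 0 #|moves_to x1 y1 r|.
  by rewrite leqn0 => /eqP ->; rewrite mulr0.
rewrite (exchange_big_dep xpredT) //= [RHS]big_mkcond /=; apply: eq_bigr => r _.
rewrite /compatible; case: asboolP => [[x [y [xyr xy]]]|nr]; last first.
  rewrite big_pred0 // => k; apply/negP => /andP[_ /asboolP[x [y [xyr xk yk]]]].
  by apply: nr; exists x, y; split=> //; rewrite xk yk; exact: cart.1.
have [s' [[b's f's] _]] := cart.2 _ _ xy.
have [k [g gk]] := repS s'.
have kr : over (rep k) r.
  rewrite -(gact_inv g (rep k)) gk; apply: over_act.
  by exists x, y.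
rewrite (big_pred1 k) // => k'; rewrite /=; apply/andP/eqP => [[_ /asboolP k'r]|->].
  by have [h /repI] := over_uniq k'r kr.
split; apply/asboolP => //.
have [h hx] := csurj_transitive hX x0 x.
exists (g^-1 * h)%g; rewrite gactM (gmap_csurj phi hx) -b's -gk gmap_equivariant.
by rewrite gact_inv.
Qed.

Context (l : nat) (pi : gmap (csurj_gset X l) T).
Context (pi_tight : forall u : csurj X l, tight u (gstab (pi u))).
Context (alpha : 'I_m -> 'I_l) (beta : 'I_n -> 'I_l).
Context (alphaP : forall x u, lab u =1 alpha \o lab x -> f (phi x) = pi u).
Context (betaP : forall y u, lab u =1 beta \o lab y -> b (psi y) = pi u).
Context (alpha_surj : forall k, exists i, alpha i = k).
Context (beta_surj : forall k, exists j, beta j = k).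
Context (ew : forall k, (((1 + w) ^+ k - 1) ^+ 2 = w * ((1 + w) ^+ k - 1))%R).

Lemma csurj_post q (x : csurj X q) k (g : 'I_q -> 'I_k) :
  (forall j, exists i, g i = j) -> exists u : csurj X k, lab u = g \o lab x.
Proof.
move=> gs; apply: (loc_const_csurj (loc_const_comp g (loc_const_lab x))).
by move=> j; have [i <-] := gs j; have [p <-] := lab_surj x i; exists p.
Qed.

(** With T covered by X(l) through pi, the images of x and y in X(l) lie in the same
    fiber of pi when they differ by a unique label map c. So the compatible
    relations are the disjoint union over c of the ample relations for alpha and
    c \o beta. *)
Lemma sum_compatible (v : csurj X l) :
  (w ^+ l * \sum_(r | compatible r) w ^+ #|r| =
   w ^+ (m + n) * #|moves v (gstab (pi v))|%:R)%R.
Proof.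
have moves_surj c : c \in moves v (gstab (pi v)) -> forall k, exists j, c (beta j) = k.
  case/movesP => g _ gc k; have [p <-] := lab_surj (csurj_act g v) k.
  by have [j bj] := beta_surj (lab v p); exists j; rewrite bj -gc.
transitivity (\sum_(c in moves v (gstab (pi v))) w ^+ l *
    \sum_(r | ample alpha (c \o beta) r) w ^+ #|r|)%R; last first.
  rewrite mulr_natr -sumr_const; apply: eq_bigr => c cv.
  have := sum_ample ew alpha_surj (moves_surj c cv).
  by rewrite !card_ord.
rewrite -mulr_sumr; congr (_ * _)%R.
rewrite (exchange_big_dep xpredT) //= [LHS]big_mkcond /=; apply: eq_bigr => r _.
rewrite /compatible; case: asboolP => [[x [y [xyr xy]]]|nr]; last first.
  rewrite big_pred0 // => c; apply/negP => /andP[cv /and3P[/forallP ri /forallP rj /forallP rij]].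
  apply: nr.
  have r0 : (0 < #|r|)%N.
    have [p0 _] := cantor_point hX.
    have [j _] := beta_surj (lab v p0).
    by have /existsP[i ij] := rj j; apply/card_gt0P; exists (i, j).
  have [x [y xy]] := joint_exists r0 (fun i => existsP (ri i)) (fun j => existsP (rj j)).
  exists x, y; split=> //.
  have [u uE] := csurj_post x alpha_surj.
  have [u' u'E] := csurj_post y beta_surj.
  rewrite -(moves_over v u') in cv.
  have [u2 u2u' u2E] := moves_fiber cv.
  have uu2 : u = u2.
    apply: lab_inj => p; rewrite u2E uE u'E /=.
    have /implyP/(_ _)/eqP := rij (lab x p, lab y p); apply.
    by rewrite -xy; apply/labelsP; exists p.
  by rewrite (alphaP (u := u)) ?uE // (betaP (u := u')) ?u'E // uu2.
have [u uE] := csurj_post x alpha_surj.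
have [u' u'E] := csurj_post y beta_surj.
have uu' : pi u = pi u'.
  by rewrite -(alphaP (x := x)) ?uE // -(betaP (y := y)) ?u'E.
have [c cu cE] := fiber_moves (pi_tight u') uu'.
rewrite (moves_over v u') in cu.
have cr : ample alpha (c \o beta) r.
  rewrite -xyr; apply/and3P; split; apply/forallP.
  - by move=> i; apply/existsP; exact: (joint_ample x y).1.
  - by move=> j; apply/existsP; exact: (joint_ample x y).2.
  - move=> [i j]; apply/implyP => /labelsP[p [<- <-]] /=; apply/eqP.
    by have := cE p; rewrite uE u'E.
rewrite (big_pred1 c) // => c'; rewrite /=; apply/andP/eqP => [[_ c'r]|->//].
apply/ffunP => k; have [j <-] := beta_surj k.
case/and3P: cr => _ /forallP/(_ j)/existsP[i ij] /forallP/(_ (i, j)).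
rewrite ij /= => /eqP <-.
by case/and3P: c'r => _ _ /forallP/(_ (i, j)); rewrite ij /= => /eqP <-.
Qed.

(** Base change for an orbit of S, read off from [sum_point_mass_over] and
    [sum_compatible] by substituting the point masses. *)
Lemma point_mass_pullback (I : finType) (rep : I -> S') (x0 : csurj X m) (y0 : csurj X n)
    (v : csurj X l) :
  w != 0%R -> is_reps rep -> (forall t', exists y, psi y = t') ->
  ((\sum_(k | `[< exists g, gact g (phi x0) = b' (rep k) >]) point_mass w (rep k)) *
     point_mass w (pi v) = point_mass w (phi x0) * point_mass w (psi y0))%R.
Proof.
move=> w0 repS psi_surj.
have := sum_point_mass_over x0 y0 repS psi_surj.
have := sum_compatible v.
rewrite /point_mass (weightE hX w (pi_tight v)) (weightE hX w (phi_tight x0)).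
rewrite (weightE hX w (psi_tight y0)) /weight_at.
have -> : (\sum_(r | compatible r) w ^+ #|r| = w * \sum_(r | compatible r) w ^+ #|r|.-1)%R.
  rewrite mulr_sumr; apply: eq_bigr => r /asboolP[x [y [<- _]]].
  rewrite -exprS prednK //; have [p0 _] := cantor_point hX.
  by apply/card_gt0P; exists (lab x p0, lab y p0); apply/labelsP; exists p0.
set Q := (\sum_(r | compatible r) w ^+ #|r|.-1)%R.
set M := (\sum_(k | _) _)%R.
have nz k (u : csurj X k) (V : gset X) (q : V) : (#|moves u (gstab q)|%:R : K)%R != 0%R.
  by rewrite pnatr_eq0 -lt0n; apply: moves_gt0; exact: gact1.
move: (nz _ v _ (pi v)) (nz _ x0 _ (phi x0)) (nz _ y0 _ (psi y0)).
rewrite natrM.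
move: (#|moves v _|%:R)%R (#|moves x0 _|%:R)%R (#|moves y0 _|%:R)%R => dv dx dy v0 x00 y00.
rewrite -[l](prednK (csurj_gt0 v)) -[m](prednK (csurj_gt0 x0)) -[n](prednK (csurj_gt0 y0)) /=.
rewrite addSn addnS !exprS exprD.
move: (w ^+ l.-1)%R (w ^+ m.-1)%R (w ^+ n.-1)%R (expf_neq0 l.-1 w0) => wl wm wn wl0 H HM.
clearbody Q M.
have -> : M = (Q / (dx * dy))%R by rewrite -HM mulfK // mulf_neq0.
have -> : Q = (wm * wn * dv / wl)%R.
  apply: (mulfI wl0); apply: (mulfI w0); apply: (mulfI w0).
  rewrite (_ : w * (w * (wl * Q)) = w * wl * (w * Q))%R; last by ring.
  by rewrite H; field.
by field; rewrite v0 x00 y00 wl0.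
Qed.

End Square.
End BaseChange.

(** * The measures *)

Section Measure.
Context {X : topologicalType} (hX : is_cantor_space X).
Local Notation G := (selfhomeo X).

(** Every orbit is the quotient of some X(n) by a finite group. *)
Lemma tight_cover (S : gset X) (s : S) :
  exists n (x : csurj X n) (f : gmap (csurj_gset X n) S),
    f x = s /\ forall x' : csurj X n, tight x' (gstab (f x')).
Proof.
have [n [x xs]] := tight_exists hX s.
have [f fx] := csurj_orbit_map hX xs.1.
exists n, x, f; split=> // x'; apply: (tight_over hX (x := x)).
by rewrite fx.
Qed.

(** A cover by X(m) factors through a tight cover by X(n), because the tight
    labelling is the coarsest one supporting the stabilizer. *)
Lemma cover_factor m n (S : gset X) (x0 : csurj X m) (v : csurj X n)
    (p : gmap (csurj_gset X m) S) (q : gmap (csurj_gset X n) S) :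
  p x0 = q v -> supports x0 (gstab (q v)) -> tight v (gstab (q v)) ->
  exists2 a : 'I_m -> 'I_n, forall k, exists i, a i = k &
    forall x u, lab u =1 a \o lab x -> p x = q u.
Proof.
move=> pq x0s [_ vp]; have [a aE] := tight_factor hX x0s vp.
exists a => [k|x u uE].
  by have [t <-] := lab_surj v k; exists (lab x0 t).
have [g gx] := csurj_transitive hX x0 x.
have gv : csurj_act g v = u.
  by apply: lab_inj => t; rewrite uE lab_act aE -gx.
by rewrite -(gmap_csurj p gx) -(gmap_csurj q gv) pq.
Qed.

Context (K : numFieldType) (w : K).
Context (w0 : w != 0%R).
Context (ew : forall k, (((1 + w) ^+ k - 1) ^+ 2 = w * ((1 + w) ^+ k - 1))%R).

(** The orbits of S' are sorted by their image in S; each part is the situation of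
    [point_mass_pullback]. *)
Lemma mass_base_change (S S' : fin_gset X) (T T' : trans_gset X)
    (f : gmap S T) (b : gmap T' T) (f' : gmap S' T') (b' : gmap S' S) :
  gcartesian f b f' b' ->
  (mass w S' * mass w T = mass w S * mass w T')%R.
Proof.
move=> cart; have [ns [r rS]] := reps_exist S; have [ns' [r' rS']] := reps_exist S'.
have [t' _] := (gtrans T').1.
have [n [y0 [psi [y0t' psi_tight]]]] := tight_cover t'.
have [l [v [pi [vt pi_tight]]]] := tight_cover (b t').
rewrite (mass_trans hX w (b t') (gtrans T)) (mass_trans hX w t' (gtrans T')).
rewrite (massE hX w rS) (massE hX w rS').
have psi_surj t1 : exists y, psi y = t1.
  have [g <-] := (gtrans T').2 t' t1; exists (csurj_act g y0).
  by rewrite -y0t' (gmap_csurj psi (erefl _)).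
have [||be be_surj beP] := @cover_factor _ _ _ y0 v (gcomp b psi) pi _ _ (pi_tight v).
- by rewrite vt -y0t'.
- by rewrite vt => g /(psi_tight y0).1; rewrite y0t' => gs; exact: (gstab_map b gs).
transitivity ((\sum_i (\sum_(k | `[< exists g, gact g (r i) = b' (r' k) >])
    point_mass w (r' k))) * point_mass w (b t'))%R.
  congr (_ * _)%R; rewrite (exchange_big_dep xpredT) //=; apply: eq_bigr => k _.
  have [i [g gi]] := rS.1 (b' (r' k)).
  rewrite (big_pred1 i) // => j /=; apply/asboolP/eqP => [[h hj]|->]; last by exists g.
  by apply: (rS.2 _ _ (g^-1 * h)%g); rewrite gactM hj -gi gact_inv.
rewrite !mulr_suml; apply: eq_bigr => i _.
have [g gt] := (gtrans T).2 (f (r i)) (b t').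
have [m [x0 [phi [x0s phi_tight]]]] := tight_cover (gact g (r i)).
have fs : f (gact g (r i)) = b t' by rewrite gmap_equivariant.
have [||al al_surj alP] := @cover_factor _ _ _ x0 v (gcomp f phi) pi _ _ (pi_tight v).
- by rewrite vt -fs -x0s.
- by rewrite vt -fs => h /(phi_tight x0).1; rewrite x0s => hs; exact: (gstab_map f hs).
rewrite -(point_mass_act hX w (r i) g) -x0s -vt -y0t'.
have := point_mass_pullback hX cart phi_tight psi_tight pi_tight alP beP al_surj be_surj ew
  x0 y0 v w0 rS' psi_surj.
move=> <-; congr (_ * _)%R; apply: eq_bigl => k; apply: asbool_equiv_eq.
rewrite x0s; split=> -[h hk].
  by exists (h * g^-1)%g; rewrite gactM gact_inv.
by exists (h * g)%g; rewrite gactM.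
Qed.

Lemma mass_iso (S T : fin_gset X) (f : gmap S T) : giso f -> mass w S = mass w T.
Proof.
move=> [f' [fK f'K]]; have [ns [r rS]] := reps_exist S.
have rT : is_reps (fun i => f (r i)).
  split=> [t|i j g].
    have [i [g gi]] := rS.1 (f' t); exists i, g.
    by rewrite -gmap_equivariant gi f'K.
  by rewrite -gmap_equivariant => /(can_inj fK)/rS.2.
rewrite (massE hX w rS) (massE hX w rT); apply: eq_bigr => i _.
rewrite /point_mass; congr (weight w _); apply/seteqP; split=> g.
  exact: gstab_map.
by rewrite /gstab /= -gmap_equivariant => /(can_inj fK).
Qed.

Lemma mass_add (S : fin_gset X) (A B : set S) (sA : gstable A) (sB : gstable B) :
  A `|` B = setT -> A `&` B = set0 ->
  mass w S = (mass w (gsub sA) + mass w (gsub sB))%R.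
Proof.
move=> AB AB0.
have [p [rA rAP]] := reps_exist (gsub sA); have [q [rB rBP]] := reps_exist (gsub sB).
pose r (k : 'I_p + 'I_q) : S :=
  match k with inl i => sval (rA i) | inr j => sval (rB j) end.
have nAB s : A s -> B s -> False.
  by move=> As Bs; have : (A `&` B) s by []; rewrite AB0.
have rP : is_reps r.
  split=> [s|[i|i] [j|j] g].
  - have : (A `|` B) s by rewrite AB.
    case=> [As|Bs].
      have [i [g gi]] := rAP.1 (exist _ s As); exists (inl i), g.
      exact: (congr1 sval gi).
    have [i [g gi]] := rBP.1 (exist _ s Bs); exists (inr i), g.
    exact: (congr1 sval gi).
  - move=> /= gij; congr inl; apply: (rAP.2 _ _ g); case: (rA j) gij => s As /= gij.
    exact: eq_exist.
  - move=> /= gij; case: (@nAB (sval (rB j))); last exact: svalP.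
    by rewrite -gij; apply: (sA); exact: svalP.
  - move=> /= gij; case: (@nAB (sval (rA j))); first exact: svalP.
    by rewrite -gij; apply: (sB); exact: svalP.
  - move=> /= gij; congr inr; apply: (rBP.2 _ _ g); case: (rB j) gij => s As /= gij.
    exact: eq_exist.
have stab_sub (C : set S) (sC : gstable C) (c : gsub sC) : gstab (sval c) = gstab c.
  apply/seteqP; split=> g; rewrite /gstab /= => gc; last exact: (congr1 sval gc).
  by case: c gc => s Cs /= gc; exact: eq_exist.
rewrite (massE hX w rP) (massE hX w rAP) (massE hX w rBP) big_sumType /=.
by congr (_ + _)%R; apply: eq_bigr => i _; rewrite /point_mass stab_sub.
Qed.

Lemma mass_neq0 (T : trans_gset X) : mass w T != 0%R.
Proof.
have [t _] := (gtrans T).1.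
by rewrite (mass_trans hX w t (gtrans T)) weight_neq0.
Qed.

Definition mass_ratio (S : fin_gset X) (T : trans_gset X) (_ : gmap S T) : K :=
  (mass w S / mass w T)%R.

Lemma mass_ratio_iso (S : fin_gset X) (T : trans_gset X) (f : gmap S T) :
  giso f -> mass_ratio f = 1%R.
Proof. by move=> /mass_iso fE; rewrite /mass_ratio fE divff // mass_neq0. Qed.

Lemma mass_ratio_add (S : fin_gset X) (T : trans_gset X) (f : gmap S T)
    (A B : set S) (sA : gstable A) (sB : gstable B) :
  A `|` B = setT -> A `&` B = set0 ->
  mass_ratio f = (mass_ratio (grestrict sA f) + mass_ratio (grestrict sB f))%R.
Proof. by move=> AB AB0; rewrite /mass_ratio (mass_add sA sB AB AB0) mulrDl. Qed.

Lemma mass_ratio_comp (S : fin_gset X) (T U : trans_gset X)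
    (f : gmap S T) (g : gmap T U) :
  mass_ratio (gcomp g f) = (mass_ratio g * mass_ratio f)%R.
Proof.
by rewrite /mass_ratio [RHS]mulrC mulrA mulfVK // mass_neq0.
Qed.

Lemma mass_ratio_base_change (S S' : fin_gset X) (T T' : trans_gset X)
    (f : gmap S T) (b : gmap T' T) (f' : gmap S' T') (b' : gmap S' S) :
  gcartesian f b f' b' -> mass_ratio f' = mass_ratio f.
Proof.
move=> /mass_base_change bc; rewrite /mass_ratio; apply/eqP.
by rewrite eqr_div ?mass_neq0 // bc.
Qed.

Definition mass_measure : gmeasure X K :=
  GMeasure mass_ratio_iso mass_ratio_add mass_ratio_comp mass_ratio_base_change.

Lemma mass_measure_regular : gregular mass_measure.
Proof.
by move=> S T f; rewrite unitfE mulf_neq0 ?invr_neq0 ?mass_neq0.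
Qed.

Lemma csurj_trans n : gtransitive (csurj_gset X n.+1).
Proof.
split; first by have [x _] := csurj_exists hX n; exists x.
by move=> x y; exact: csurj_transitive.
Qed.

Lemma mass_measure_csurj n :
  gmeas_set mass_measure (csurj_fin hX n.+1) = (w ^+ n)%R.
Proof.
have [x _] := csurj_exists hX n.
rewrite /gmeas_set /= /mass_ratio.
rewrite (mass_trans hX w (x : csurj_fin hX n.+1) (csurj_trans n)).
rewrite (mass_trans hX w (tt : gpoint X) (gtrans (gpoint X))).
rewrite /point_mass (weight_csurj hX w x) (_ : gstab _ = setT).
  by rewrite (weight_setT hX w) divr1.
by apply/seteqP; split.
Qed.

End Measure.

(** * Uniqueness of regular measures *)

Section Uniqueness.
Context {X : topologicalType} (hX : is_cantor_space X).
Local Notation G := (selfhomeo X).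

Lemma gmap_eq (S T : gset X) (f g : gmap S T) : f =1 g -> f = g.
Proof.
case: f g => f fE [g gE] /= /funext fg; subst g; congr GMap.
exact: Prop_irrelevance.
Qed.

Lemma gmeasure_eq (k : comPzRingType) (mu mu' : gmeasure X k) :
  (forall (S : fin_gset X) (T : trans_gset X) (f : gmap S T), mu S T f = mu' S T f) ->
  mu = mu'.
Proof.
case: mu mu' => m i a c b [m' i' a' c' b'] /= mm.
have E : m = m'.
  apply: functional_extensionality_dep => S; apply: functional_extensionality_dep => T.
  by apply/funext => f; exact: mm.
by subst m'; congr GMeasure; exact: Prop_irrelevance.
Qed.

Definition gid (S : gset X) : gmap S S := @GMap X S S id (fun _ _ => erefl).

Definition gincl (S : fin_gset X) (A : set S) (sA : gstable A) : gmap (gsub sA) S :=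
  @GMap X (gsub sA) S sval (fun _ _ => erefl).

Lemma gorbit_stable (S : gset X) (s : S) : gstable (gorbit s).
Proof. by move=> g _ [h _ <-]; exists (g * h)%g => //; rewrite gactM. Qed.

Lemma gorbitC_stable (S : gset X) (s : S) : gstable (~` gorbit s).
Proof.
move=> g x nx [h _ hs]; apply: nx; exists (g^-1 * h)%g => //.
by rewrite gactM hs gact_inv.
Qed.

Lemma gorbit_trans (S : fin_gset X) (s : S) : gtransitive (gsub (@gorbit_stable S s)).
Proof.
have sA : gorbit s s by exists 1%g => //; exact: gact1.
split; first by exists (exist _ s sA).
move=> [x xs] [y ys]; have [g _ gx] := xs; have [h _ hy] := ys.
by exists (h * g^-1)%g; apply: eq_exist => /=; rewrite -gx -hy gactM gact_inv.
Qed.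

Lemma inj_surj_giso (S T : gset X) (f : gmap S T) :
  injective f -> (forall t, exists s, f s = t) -> giso f.
Proof.
move=> fi /choice[h fK].
have hE g t : h (gact g t) = gact g (h t).
  by apply: fi; rewrite gmap_equivariant !fK.
exists (GMap hE); split=> //= s; exact: fi.
Qed.

Section Agree.
Context (k : comPzRingType).
Implicit Types mu : gmeasure X k.

(** Base change along the identity of T. *)
Lemma gmeas_giso mu (S S' : fin_gset X) (T : trans_gset X) (f : gmap S T)
    (h : gmap S' S) : giso h -> mu S' T (gcomp f h) = mu S T f.
Proof.
move=> [h' [hK h'K]]; apply: (@gmeas_base_change _ _ mu _ _ _ _ f (gid T) _ h).
split=> // x y fxy; exists (h' x); split; first by rewrite /= h'K.
by move=> x' [<- _]; rewrite hK.
Qed.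

(** The decomposition of the empty set in two empty sets gives mu = mu + mu. *)
Lemma gmeas_empty mu (S : fin_gset X) (T : trans_gset X) (f : gmap S T) :
  (S -> False) -> mu S T f = 0%R.
Proof.
move=> S0; have s0 : gstable (set0 : set S) by [].
have fE : grestrict s0 f = gcomp f (gincl s0) by exact: gmap_eq.
have := @gmeas_add _ _ mu S T f _ _ s0 s0.
rewrite setU0 set0I fE gmeas_giso; last first.
  by apply: inj_surj_giso => [[]//|s]; case: (S0 s).
move=> /(_ _ (erefl _)) H; apply: (@addrI _ (mu S T f)); rewrite addr0 -H //.
by apply/seteqP; split=> // s; case: (S0 s).
Qed.

(** Additivity, by induction on the number of orbits. The orbits enter through
    injective maps from transitive sets, which avoids nested subsets. *)
Lemma gmeas_eq_orbits mu mu' (T : trans_gset X) n (S : fin_gset X) (r : 'I_n -> S)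
    (f : gmap S T) : is_reps r ->
  (forall (S0 : trans_gset X) (h : gmap S0 S), injective h ->
     mu S0 T (gcomp f h) = mu' S0 T (gcomp f h)) ->
  mu S T f = mu' S T f.
Proof.
elim: n S r f => [|n IH] S r f [rS rI] mm.
  by rewrite !gmeas_empty // => s; have [[]] := rS s.
pose sA := @gorbit_stable S (r ord0); pose sB := @gorbitC_stable S (r ord0).
rewrite !(@gmeas_add _ _ _ _ _ f _ _ sA sB) ?setUv ?setICr //.
have rsE (C : set S) (sC : gstable C) : grestrict sC f = gcomp f (gincl sC).
  exact: gmap_eq.
rewrite !rsE; congr (_ + _)%R.
  apply: (mm (TransGSet (@gorbit_trans S (r ord0)))).
  by move=> [s As] [t At] /= st; exact: eq_exist.
have rB i : (~` gorbit (r ord0)) (r (lift ord0 i)).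
  by case=> g _ /rI /eqP; rewrite (negPf (neq_lift _ _)).
apply: (IH (gsub sB) (fun i => exist _ (r (lift ord0 i)) (rB i))).
  split=> [[s Bs]|i j g /(congr1 sval) /= /rI/lift_inj//].
  have [i [g gi]] := rS s; have [j ij|i0] := unliftP ord0 i.
    by exists j, g; apply: eq_exist; rewrite /= -gi ij.
  by case: Bs; exists g; rewrite // -gi i0.
move=> S0 h hi; have E : gcomp (gcomp f (gincl sB)) h = gcomp f (gcomp (gincl sB) h).
  exact: gmap_eq.
rewrite E; apply: mm => s t /= st; apply: hi.
by case: (h s) (h t) st => [x Bx] [y By] /= xy; exact: eq_exist.
Qed.

End Agree.

Section KernelPair.
Context (S : gset X) (n : nat) (phi : gmap (csurj_gset X n) S).
Context (phi_tight : forall x : csurj X n, tight x (gstab (phi x))).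

(** The fiber product of X(n) with itself over S. *)
Definition kernel_pair : Type := {xy : csurj X n * csurj X n | phi xy.1 = phi xy.2}.

Fact kernel_pair_act_subproof g (e : kernel_pair) :
  phi (csurj_act g (sval e).1) = phi (csurj_act g (sval e).2).
Proof.
by rewrite -!(gmap_csurj phi (erefl (csurj_act g _))) (svalP e).
Qed.

Definition kernel_pair_act g (e : kernel_pair) : kernel_pair :=
  exist _ (csurj_act g (sval e).1, csurj_act g (sval e).2) (kernel_pair_act_subproof g e).

Fact kernel_pair_act1 e : kernel_pair_act 1%g e = e.
Proof. by case: e => [[x y] xy]; apply: eq_exist; rewrite /= !csurj_act1. Qed.

Fact kernel_pair_actM g h e :
  kernel_pair_act (g * h)%g e = kernel_pair_act g (kernel_pair_act h e).
Proof. by apply: eq_exist; rewrite /= !csurj_actM. Qed.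

Fact kernel_pair_smooth e : open [set g : G | kernel_pair_act g e = e].
Proof.
case: e => [[x y] xy].
rewrite (_ : [set g | _] = [set g | csurj_act g x = x] `&` [set g | csurj_act g y = y]).
  by apply: openI; exact: csurj_smooth.
apply/seteqP; split=> g /=; first by move=> /(congr1 sval) [].
by case=> gx gy; apply: eq_exist; rewrite /= gx gy.
Qed.

Definition kernel_pair_gset : gset X := GSet kernel_pair_act1 kernel_pair_actM kernel_pair_smooth.

Lemma kernel_pair_moves (e : kernel_pair) : exists c : {ffun 'I_n -> 'I_n},
  forall p, lab (sval e).1 p = c (lab (sval e).2 p).
Proof. by have [c _ cE] := fiber_moves hX (phi_tight _) (svalP e); exists c. Qed.

Fact kernel_pair_finitary : finite_set (range (@gorbit _ kernel_pair_gset)).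
Proof.
pose O (c : {ffun 'I_n -> 'I_n}) : set kernel_pair_gset :=
  [set e | forall p, lab (sval e).1 p = c (lab (sval e).2 p)].
apply: (sub_finite_set _ (finite_image O (@finite_finset _ setT))).
move=> _ [e _ <-]; have [c cE] := kernel_pair_moves e; exists c => //.
apply/seteqP; split=> [e' ce'|_ [g _ <-] p]; last by rewrite !lab_act cE.
have [g ge] := csurj_transitive hX (sval e).2 (sval e').2.
exists g => //; case: e e' ge cE ce' => [[x y] xy] [[x' y'] xy'] /= gy cE ce'.
apply: eq_exist; congr pair => //=; apply: lab_inj => p.
by rewrite lab_act cE ce' /= -gy.
Qed.

Definition kernel_pair_fin : fin_gset X := FinGSet kernel_pair_finitary.

Definition kernel_pair_fst : gmap kernel_pair_fin (csurj_gset X n) :=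
  @GMap X kernel_pair_fin (csurj_gset X n) (fun e => (sval e).1) (fun _ _ => erefl).
Definition kernel_pair_snd : gmap kernel_pair_fin (csurj_gset X n) :=
  @GMap X kernel_pair_fin (csurj_gset X n) (fun e => (sval e).2) (fun _ _ => erefl).

Lemma kernel_pair_cartesian : gcartesian phi phi kernel_pair_snd kernel_pair_fst.
Proof.
split=> [e|x y xy]; first exact: (svalP e).
exists (exist _ (x, y) xy); split=> // -[[x' y'] xy'] [/= ? ?]; subst.
exact: eq_exist.
Qed.

(** An element of G fixing y fixes all label maps applied to y, and the pairs in the
    kernel pair are of the form (c \o y, y). *)
Lemma kernel_pair_snd_giso (S0 : trans_gset X) (h : gmap S0 kernel_pair_fin) :
  injective h -> giso (gcomp kernel_pair_snd h).
Proof.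
move=> hi; apply: inj_surj_giso => [s1 s2 /= s12|y].
  have [g gs] := (gtrans S0).2 s1 s2; apply: hi.
  move: s12; rewrite -gs gmap_equivariant; case: (h s1) => [[x y] xy] /= yg.
  apply: eq_exist; congr pair => //=; apply: lab_inj => p.
  have [c cE] := kernel_pair_moves (exist _ (x, y) xy); rewrite /= in cE.
  by rewrite lab_act !cE -lab_act -yg.
have [s0 _] := (gtrans S0).1.
have [g gy] := csurj_transitive hX (kernel_pair_snd (h s0)) y.
by exists (gact g s0); rewrite gmap_equivariant.
Qed.

End KernelPair.

Section Unique.
Context (k : comUnitRingType) (mu mu' : gmeasure X k).

(** By base change along phi itself, the value at phi is the value at the projection
    of the kernel pair, hence the number of its orbits, whatever the measure. *)
Lemma gmeas_tight_cover n (S : trans_gset X) (phi : gmap (csurj_fin hX n.+1) S) :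
  (forall x : csurj X n.+1, tight x (gstab (phi x))) ->
  mu _ S phi = mu' _ S phi.
Proof.
move=> phi_tight.
pose T := @TransGSet X (csurj_fin hX n.+1) (csurj_trans hX n).
have cart := kernel_pair_cartesian phi_tight.
rewrite -(@gmeas_base_change _ _ mu (csurj_fin hX n.+1) (kernel_pair_fin phi_tight) S T
  phi phi (kernel_pair_snd phi_tight) (kernel_pair_fst phi_tight) cart).
rewrite -(@gmeas_base_change _ _ mu' (csurj_fin hX n.+1) (kernel_pair_fin phi_tight) S T
  phi phi (kernel_pair_snd phi_tight) (kernel_pair_fst phi_tight) cart).
have [m [r rP]] := reps_exist (kernel_pair_fin phi_tight).
apply: (gmeas_eq_orbits rP) => S0 h hi.
by rewrite !gmeas_iso //; exact: kernel_pair_snd_giso.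
Qed.

Context (mu'_reg : gregular mu').
Context (mu_csurj : forall n,
  gmeas_set mu (csurj_fin hX n.+1) = gmeas_set mu' (csurj_fin hX n.+1)).

(** Multiplicativity in X(n) -> S -> 1, where the first factor is a unit. *)
Lemma gmeas_set_trans (S : trans_gset X) : gmeas_set mu S = gmeas_set mu' S.
Proof.
have [s _] := (gtrans S).1.
have [n [x [phi [_ phi_tight]]]] := tight_cover hX s.
case: n x phi phi_tight => [x|n x phi phi_tight]; first by have := csurj_gt0 hX x.
have muphi := @gmeas_tight_cover n S phi phi_tight.
have := mu_csurj n; rewrite /gmeas_set.
have -> : gto_point (csurj_fin hX n.+1) = gcomp (gto_point S) phi by exact: gmap_eq.
rewrite !gmeas_comp muphi => /mulIr; apply.
exact: (@mu'_reg (@TransGSet X (csurj_fin hX n.+1) (csurj_trans hX n)) S phi).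
Qed.

Lemma regular_gmeasure_uniq : mu = mu'.
Proof.
apply: gmeasure_eq => S T f; have [m [r rP]] := reps_exist S.
apply: (gmeas_eq_orbits rP) => S0 h _; move: (gcomp f h) => {}f.
have := gmeas_set_trans S0; rewrite /gmeas_set.
have -> : gto_point S0 = gcomp (gto_point T) f by exact: gmap_eq.
rewrite !gmeas_comp; have := gmeas_set_trans T; rewrite /gmeas_set => ->.
apply: mulrI; exact: mu'_reg.
Qed.

End Unique.
End Uniqueness.

Local Open Scope ring_scope.

Lemma exists_unique_measure (X : topologicalType) (hX : is_cantor_space X)
    (K : numFieldType) (w : K) :
  w != 0 -> (forall k, ((1 + w) ^+ k - 1) ^+ 2 = w * ((1 + w) ^+ k - 1)) ->
  exists! mu : gmeasure X K, gregular mu /\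
     forall n : nat, (1 <= n)%N -> gmeas_set mu (csurj_fin hX n) = w ^+ n.-1.
Proof.
move=> w0 ew; exists (mass_measure hX w0 ew); split.
  split; first exact: mass_measure_regular.
  by case=> // n _; exact: mass_measure_csurj.
move=> nu [nu_reg nuE]; apply: (regular_gmeasure_uniq nu_reg) => n.
by rewrite nuE // mass_measure_csurj.
Qed.

Theorem theorem4p2 (X : topologicalType) (hX : is_cantor_space X) :
  (exists! mu : gmeasure X rat,
     gregular mu /\
     forall n : nat, (1 <= n)%N ->
       gmeas_set mu (csurj_fin hX n) = (- 2%:R) ^+ n.-1) /\
  (exists! nu : gmeasure X rat,
     gregular nu /\
     forall n : nat, (1 <= n)%N ->
       gmeas_set nu (csurj_fin hX n) = (- 1) ^+ n.-1).
Proof.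
split; apply: exists_unique_measure => // k.
  have -> : 1 + - 2%:R = -1 :> rat by [].
  by rewrite -signr_odd; case: odd.
by rewrite subrr; case: k => [|k]; rewrite ?expr0n ?expr0 ?exprS ?mul0r.
Qed.
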